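(* Let $\Omega$ be a hyper-solvable sesquilinear form on $\mathcal{D}$ with respect to a norm $\|\cdot\|_\Omega$ and with associated operator $T$. Then $$\Omega(\xi,\eta)=\langle U|T|^{1/2}\xi,\ |T^*|^{1/2}\eta\rangle,\qquad \forall\,\xi,\eta\in\mathcal{D},$$ $$\Omega(\xi,\eta)=\langle |T^*|^{1/2}U\xi,\ |T^*|^{1/2}\eta\rangle,\qquad \forall\,\xi,\eta\in\mathcal{D},$$ where $T=U|T|=|T^*|U$ is the polar decomposition of $T$, and $\|\cdot\|_\Omega$ is equivalent to the graph norms of $|T|^{1/2}$ and of $|T^*|^{1/2}$.
   Context: $\mathcal{H}$ is a complex Hilbert space with inner product $\langle\cdot,\cdot\rangle$ (linear in the first variable) and norm $\|\cdot\|$; $\mathcal{D}$ is a dense subspace of $\mathcal{H}$; sesquilinear forms are linear in the first and conjugate-linear in the second variable. $\mathcal{B}(\mathcal{H})$ is the set of bounded everywhere defined operators on $\mathcal{H}$. A sesquilinear form $\Omega$ on $\mathcal{D}$ is q-closed with respect to a norm $\|\cdot\|_\Omega$ on $\mathcal{D}$ if: (i) there is $\alpha>0$ with $\|\xi\|\le\alpha\|\xi\|_\Omega$ for all $\xi\in\mathcal{D}$; (ii) $\mathcal{E}_\Omega:=(\mathcal{D},\|\cdot\|_\Omega)$ is a reflexive Banach space; (iii) there is $\beta>0$ with $|\Omega(\xi,\eta)|\le\beta\|\xi\|_\Omega\|\eta\|_\Omega$ for all $\xi,\eta\in\mathcal{D}$. Let $\mathcal{E}_\Omega^\times$ be the space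 of bounded conjugate linear functionals on $\mathcal{E}_\Omega$. $\mathfrak{P}(\Omega)$ is the set of bounded sesquilinear forms $\Upsilon$ on $\mathcal{H}$ such that: (1) if $\xi\in\mathcal{D}$ and $(\Omega+\Upsilon)(\xi,\eta)=0$ for all $\eta\in\mathcal{D}$ then $\xi=0$; (2) for every $\Lambda\in\mathcal{E}_\Omega^\times$ there is $\xi\in\mathcal{D}$ with $\Lambda(\eta)=(\Omega+\Upsilon)(\xi,\eta)$ for all $\eta\in\mathcal{D}$. $\Omega$ is solvable with respect to $\|\cdot\|_\Omega$ if it is q-closed with respect to $\|\cdot\|_\Omega$ and $\mathfrak{P}(\Omega)\neq\emptyset$. The operator $T$ associated to a solvable form $\Omega$ is given by: $\xi\in D(T)$ and $T\xi=\chi$ if and only if $\xi\in\mathcal{D}$, $\chi\in\mathcal{H}$ and $\Omega(\xi,\eta)=\langle\chi,\eta\rangle$ for all $\eta\in\mathcal{D}$. It is known that $T$ is closed and densely defined. A solvable form $\Omega$ on $\mathcal{D}$ (with respect to $\|\cdot\|_\Omega$) with associated operator $T$ is hyper-solvable (with respect to $\|\cdot\|_\Omega$) if $\mathcal{D}=D(|T|^{1/2})$, where $|T|=(T^*T)^{1/2}$. The graph norm of a closed operator $A$ is $\xi\mapsto(\|\xi\|^2+\|A\xi\|^2)^{1/2}$ on $D(A)$. *)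

(* Defs.v *)
From HB Require Import structures.
From mathcomp Require Import all_boot all_order all_algebra.
From mathcomp Require Import sesquilinear complex.
From mathcomp Require Import all_classical all_reals all_analysis.
Import GRing.Theory Num.Theory.
Import numFieldNormedType.Exports.
Set Implicit Arguments.
Unset Strict Implicit.
Unset Printing Implicit Defensive.

Local Open Scope classical_set_scope.
Local Open Scope ring_scope.
Local Open Scope relation_scope.

(* A Hilbert space is a complete normed module [H] over [R[i]] together with an
   inner product [ip : {dot H for Num.conj}] (linear in the first argument,
   conjugate-linear in the second) that induces the norm of [H].  As for the
   library's norm on [H], all norms and bounds take values in [R[i]], where
   [0 <= z] means that [z] is a nonnegative real. *)

Section Definitions.
Context (R : realType) (H : completeNormedModType R[i]).
Implicit Types (D : set H) (N : H -> R[i]) (f L : H -> R[i]).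

Definition induces_norm (ip : {dot H for (@Num.conj R[i])}) : Prop :=
  forall x : H, `|x| ^+ 2 = ip x x.

(** Forms, functionals and norms on a subspace: total functions on [H] of which
    only the values on [D] matter. *)

Definition linear_subspace D : Prop :=
  D 0 /\ forall (a : R[i]) x y, D x -> D y -> D (a *: x + y).

Definition sesquilinear_on D (F : H -> H -> R[i]) : Prop :=
  forall (a : R[i]) x y z, D x -> D y -> D z ->
    F (a *: x + y) z = a * F x z + F y z /\
    F z (a *: x + y) = a^*%R * F z x + F z y.

Definition linear_on D f : Prop :=
  forall (a : R[i]) x y, D x -> D y -> f (a *: x + y) = a * f x + f y.

Definition conj_linear_on D L : Prop :=
  forall (a : R[i]) x y, D x -> D y -> L (a *: x + y) = a^*%R * L x + L y.

Definition norm_on D N : Prop :=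
  [/\ forall x, D x -> 0 <= N x,
      forall x, D x -> N x = 0 -> x = 0,
      forall (a : R[i]) x, D x -> N (a *: x) = `|a| * N x &
      forall x y, D x -> D y -> N (x + y) <= N x + N y].

Definition equivalent_norms D N N' : Prop :=
  exists c C : R[i], [/\ 0 < c, 0 < C &
    forall x, D x -> c * N x <= N' x /\ N' x <= C * N x].

Definition bounded_on D N f : Prop :=
  exists M : R[i], forall x, D x -> `|f x| <= M * N x.

Definition banach_on D N : Prop :=
  forall u : nat -> H, (forall n, D (u n)) ->
    (forall e : R[i], 0 < e ->
       exists n0, forall m n, (n0 <= m)%N -> (n0 <= n)%N -> N (u m - u n) < e) ->
    exists2 x, D x & forall e : R[i], 0 < e ->
       exists n0, forall n, (n0 <= n)%N -> N (u n - x) < e.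

Definition dual_on D N : set (H -> R[i]) :=
  [set f | linear_on D f /\ bounded_on D N f].

Definition dual_norm D N f : R[i] :=
  (sup [set complex.Re `|f x| | x in [set x | D x /\ N x <= 1]])%:C%C.

(* Functionals that agree on [D] differ by one of dual norm 0, so [Phi]
   automatically takes the same value on them. *)
Definition bidual_on D N : set ((H -> R[i]) -> R[i]) :=
  [set Phi |
    (forall (a : R[i]) f g, dual_on D N f -> dual_on D N g ->
       Phi (fun x => a * f x + g x) = a * Phi f + Phi g) /\
    (exists K : R[i], forall f, dual_on D N f ->
       `|Phi f| <= K * dual_norm D N f)].

Definition reflexive_on D N : Prop :=
  forall Phi, bidual_on D N Phi ->
    exists2 x, D x & forall f, dual_on D N f -> Phi f = f x.

(** Solvable forms. *)

Definition q_closed D N (Omega : H -> H -> R[i]) : Prop :=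
  [/\ exists2 alpha : R[i], 0 < alpha &
        forall x, D x -> `|x| <= alpha * N x,
      banach_on D N, reflexive_on D N &
      exists2 beta : R[i], 0 < beta &
        forall x y, D x -> D y -> `|Omega x y| <= beta * N x * N y].

Definition bounded_form (Y : H -> H -> R[i]) : Prop :=
  sesquilinear_on setT Y /\
  exists M : R[i], forall x y, `|Y x y| <= M * `|x| * `|y|.

Definition perturbations D N (Omega : H -> H -> R[i]) : set (H -> H -> R[i]) :=
  [set Y | [/\ bounded_form Y,
    forall x, D x -> (forall y, D y -> Omega x y + Y x y = 0) -> x = 0 &
    forall L, conj_linear_on D L -> bounded_on D N L ->
      exists2 x, D x & forall y, D y -> L y = Omega x y + Y x y]].

Definition solvable_form D N (Omega : H -> H -> R[i]) : Prop :=
  q_closed D N Omega /\ perturbations D N Omega !=set0.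

(** Unbounded operators, given by their graphs. For the library's composition
    of relations, [A \; B] is the operator product [AB] (first [B], then [A]),
    with its natural domain. *)

Implicit Types A B T : set (H * H).

Definition dom A : set H := fst @` A.

Definition app A (x : H) : H := xget 0 [set y | A (x, y)].

Definition graph (U : H -> H) : set (H * H) := [set p | p.2 = U p.1].

Definition graph_norm A (x : H) : R[i] := sqrtC (`|x| ^+ 2 + `|app A x| ^+ 2).

Variable ip : {dot H for (@Num.conj R[i])}.

(* A single-valued operator when [A] is densely defined. *)
Definition adj A : set (H * H) :=
  [set p | forall q, A q -> ip q.2 p.1 = ip q.1 p.2].

Definition positive_selfadjoint A : Prop :=
  [/\ dense (dom A), adj A = A & forall p, A p -> 0 <= ip p.2 p.1].

(* The positive self-adjoint square root (unique when it exists); the empty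
   relation, which is not a linear operator, if there is none. *)
Definition op_sqrt A : set (H * H) :=
  xget set0 [set B | positive_selfadjoint B /\ B \; B = A].

Definition op_abs T : set (H * H) := op_sqrt (adj T \; T).

Definition partial_isometry (U : {linear H -> H}) : Prop :=
  (exists M : R[i], forall x, `|U x| <= M * `|x|) /\
  forall x, (forall k, U k = 0 -> ip x k = 0) -> `|U x| = `|x|.

(* The kernel condition makes [U] unique. *)
Definition polar_decomposition T (U : {linear H -> H}) : Prop :=
  [/\ partial_isometry U, T = graph U \; op_abs T &
      forall x, U x = 0 <-> T (x, 0)].

Definition associated_operator D (Omega : H -> H -> R[i]) : set (H * H) :=
  [set p | D p.1 /\ forall y, D y -> Omega p.1 y = ip p.2 y].

Definition hyper_solvable D N (Omega : H -> H -> R[i]) : Prop :=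
  solvable_form D N Omega /\
  D = dom (op_sqrt (op_abs (associated_operator D Omega))).

End Definitions.

(* Main.v *)
(* Write P = |T|, S = |T|^(1/2) and V = U^*.  Hyper-solvability forces P and S to
   exist; that P maps into the initial space of U gives T^* = P V, T^** = T and
   |T^*| = U P V, |T^*|^(1/2) = U S V, once positive self-adjoint square roots are
   known to be unique (this is proved with Cayley transforms instead of the
   spectral theorem).

   Both the given norm and the graph norm of S are complete on D = dom S, so they
   are equivalent by the closed graph theorem.  Testing the form on
   (1 + S)^-1 z with z in D shows that V D is contained in dom S and that
   Omega(x, y) = <S x, S V y>, which is the first representation.  Conversely, if
   V y is in dom S then x |-> <S x, S V y> + Y(x, y) is represented by some d in D
   through Omega + Y, and y - d is orthogonal to the range of T + Y, which is H.
   Hence D = dom |T^*|^(1/2). *)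
Require Import Defs.
From HB Require Import structures.
From mathcomp Require Import all_boot all_order all_algebra.
From mathcomp Require Import sesquilinear complex.
From mathcomp Require Import all_classical all_reals all_analysis.
Import numFieldNormedType.Exports.
Local Open Scope classical_set_scope.
Local Open Scope ring_scope.
Set Implicit Arguments.
Unset Strict Implicit.
Unset Printing Implicit Defensive.
From mathcomp Require Import ring.
Import Order.TTheory GRing.Theory Num.Theory.

(** The form lives on the subspace [D], whereas Riesz representation and adjoints of bounded maps
    live on [H]. The resolvent [J = (1 + S)^-1] bridges the two: it maps [H] isometrically onto [D]
    under the norm of [x + S x], hence is bounded for [N], and functionals and forms on [D] are
    pulled back along it to bounded ones on [H]. It also settles domains: as [S (J z) = z - J z],
    the vector [J z] is in the domain of [S^2] as soon as [z] is in that of [S].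

    The last inclusion is shaped by an asymmetry. Solvability finds a first argument of [Omega + Y],
    while a second argument has to be found there. After the pull-back this becomes surjectivity of
    the adjoint of a bounded bijection of [H]. *)

Section ComplexScalars.
Context (R : realType).
Implicit Types (x e : R[i]).

(** The order of [R[i]] is partial, but a nonnegative element equals its real part, which reduces
    the claim to [R]. *)
Lemma complex_archi x : 0 <= x -> exists n, x < n%:R.
Proof.
move=> x0; have xE : (complex.Re x)%:C%C = x by apply: RRe_real; exact: ger0_real.
exists (Num.bound (complex.Re x)).
rewrite -xE -(rmorph_nat (real_complex R)) ltcR.
by apply: archi_boundP; rewrite -ler0c xE.
Qed.

Lemma complex_pow2_lt e : 0 < e -> exists n, 2%:R ^- n < e.
Proof.
move=> e0; have ei : 0 <= e^-1 by rewrite invr_ge0 ltW.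
have [n hn] := complex_archi ei.
exists n; rewrite -[e]invrK ltf_pV2 ?posrE ?invr_gt0 ?exprn_gt0 //.
apply: (lt_le_trans hn); rewrite -natrX ler_nat; exact/ltnW/ltn_expl.
Qed.

Lemma pow2_le m n : (m <= n)%N -> 2%:R ^- n <= 2%:R ^- m :> R[i].
Proof.
by move=> mn; rewrite lef_pV2 ?posrE ?exprn_gt0 // ler_eXn2l // ltr1n.
Qed.
End ComplexScalars.

(** * Inner product identities, Cauchy-Schwarz, testing on a dense set *)

Section HilbertSpace.
Context (R : realType) (H : completeNormedModType R[i]).
Implicit Types (x y z : H) (a b : R[i]) (M : set H).

Lemma norm_on_norm M : norm_on M (fun x : H => `|x|).
Proof.
split=> [x _|x _ /eqP|a x _|x y _ _]; first exact: normr_ge0.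
- by rewrite normr_eq0 => /eqP.
- exact: normrZ.
- exact: ler_normD.
Qed.

Lemma banach_on_setT : banach_on setT (fun x : H => `|x|).
Proof.
move=> u _ cu; have cvu : cvgn u.
  apply/cauchy_cvgP/cauchy_ballP => e e0.
  have [n0 h] := cu _ e0.
  exists (u @` [set n | (n0 <= n)%N], u @` [set n | (n0 <= n)%N]) => /=.
    by split; exists n0 => // n hn /=; exists n.
  by case=> _ _ /= [[m hm <-] [n hn <-]]; rewrite -ball_normE /=; apply: h.
exists (limn u) => // e e0.
have /cvgrPdist_lt/(_ _ e0) [n0 _ h] := cvu.
by exists n0 => n hn; rewrite distrC; apply: h.
Qed.

Lemma denseP M :
  dense M <-> forall x e, 0 < e -> exists2 y, M y & `|x - y| < e.
Proof.
split=> [dM x e e0|h O [x Ox] oO].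
  have [||y [xy My]] := dM (ball x e); first by exists x; exact: ballxx.
    exact: ball_open.
  by exists y => //; move: xy; rewrite -ball_normE.
have /nbhs_ballP[e /= e0 eO] := open_nbhs_nbhs (conj oO Ox).
have [y My xy] := h x e e0; exists y; split=> //.
by apply: eO; rewrite -ball_normE.
Qed.

Context (ip : {dot H for (@Num.conj R[i])}) (hH : induces_norm ip).

Lemma ipC x y : ip x y = (ip y x)^*.
Proof. by rewrite (hermC ip) expr0 mul1r. Qed.
Lemma ipDl x y z : ip (x + y) z = ip x z + ip y z.
Proof. exact: linearDl. Qed.
Lemma ipDr x y z : ip z (x + y) = ip z x + ip z y.
Proof. exact: linearDr. Qed.
Lemma ipNl x z : ip (- x) z = - ip x z.
Proof. exact: linearNl. Qed.
Lemma ipNr x z : ip z (- x) = - ip z x.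
Proof. exact: linearNr. Qed.
Lemma ipBl x y z : ip (x - y) z = ip x z - ip y z.
Proof. by rewrite ipDl ipNl. Qed.
Lemma ipBr x y z : ip z (x - y) = ip z x - ip z y.
Proof. by rewrite ipDr ipNr. Qed.
Lemma ipZl a x z : ip (a *: x) z = a * ip x z.
Proof. exact: linearZl_LR. Qed.
Lemma ipZr a x z : ip z (a *: x) = a^* * ip z x.
Proof. exact: linearZr_LR. Qed.
Lemma ip0l z : ip 0 z = 0.
Proof. exact: linear0l. Qed.
Lemma ip0r z : ip z 0 = 0.
Proof. exact: linear0r. Qed.
Definition ipE := (ipDl, ipDr, ipNl, ipNr, ipZl, ipZr, ip0l, ip0r).

Lemma ip_self_eq0 x : ip x x = 0 -> x = 0.
Proof. by rewrite -hH => /eqP; rewrite expf_eq0 /= normr_eq0 => /eqP. Qed.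

Lemma ip_inj x y : (forall z, ip z x = ip z y) -> x = y.
Proof.
by move=> h; apply/eqP; rewrite -subr_eq0; apply/eqP/ip_self_eq0; rewrite ipBr h subrr.
Qed.

Lemma ip_injl x y : (forall z, ip x z = ip y z) -> x = y.
Proof. by move=> h; apply: ip_inj => z; rewrite ipC h -ipC. Qed.

Lemma sqr_norm_sub x y : `|x - y| ^+ 2 = `|x| ^+ 2 - (ip x y + ip y x) + `|y| ^+ 2.
Proof. rewrite !hH !ipE; ring. Qed.

Lemma sqr_norm_add x y : `|x + y| ^+ 2 = `|x| ^+ 2 + (ip x y + ip y x) + `|y| ^+ 2.
Proof. rewrite !hH !ipE; ring. Qed.

Lemma parallelogram x y :
  `|x + y| ^+ 2 + `|x - y| ^+ 2 = 2%:R * `|x| ^+ 2 + 2%:R * `|y| ^+ 2.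
Proof. rewrite sqr_norm_add sqr_norm_sub; ring. Qed.

(** Pythagoras for the component of [x] along [y]; it yields both Cauchy-Schwarz and the variational
    step of the projection theorem. *)
Lemma sqr_norm_proj x y : y != 0 ->
  `|x - (ip x y / `|y| ^+ 2) *: y| ^+ 2 = `|x| ^+ 2 - `|ip x y| ^+ 2 / `|y| ^+ 2.
Proof.
move=> y0; have n0 : `|y| ^+ 2 != 0 by rewrite expf_eq0 /= normr_eq0.
have nc : (`|y| ^+ 2)^* = `|y| ^+ 2 by rewrite geC0_conj // exprn_ge0.
rewrite sqr_norm_sub normrZ exprMn !ipE (ipC y x) !normCK !rmorphM /= fmorphV /=.
rewrite nc; move: n0; set n := `|y| ^+ 2 => n0; by field.
Qed.

Lemma ip_cauchy_schwarz x y : `|ip x y| <= `|x| * `|y|.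
Proof.
have [->|y0] := eqVneq y 0; first by rewrite ip0r !normr0 mulr0.
have n0 : 0 < `|y| ^+ 2 by rewrite exprn_gt0 ?normr_gt0.
have := exprn_ge0 2 (normr_ge0 (x - (ip x y / `|y| ^+ 2) *: y)).
rewrite sqr_norm_proj // subr_ge0 ler_pdivrMr // -exprMn.
by rewrite ler_pXn2r // ?nnegrE ?mulr_ge0.
Qed.

Lemma ip_dense_eq0 M x : dense M -> (forall y, M y -> ip y x = 0) -> x = 0.
Proof.
move=> /denseP dM h; apply/eqP; rewrite -normr_le0; apply/ler_addgt0Pr => e e0.
rewrite add0r; have [->|x0] := eqVneq x 0; first by rewrite normr0 ltW.
have [y My xy] := dM x e e0.
have : `|x| ^+ 2 <= e * `|x|.
  have -> : `|x| ^+ 2 = `|ip (x - y) x|.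
    by rewrite ipBl (h y My) subr0 -hH normrX normr_id.
  apply: (le_trans (ip_cauchy_schwarz _ _)).
  by rewrite ler_wpM2r // ltW.
by rewrite expr2 ler_pM2r ?normr_gt0.
Qed.

End HilbertSpace.

(** * Orthogonal projection and Riesz representation *)

Section Projection.
Context (R : realType) (H : completeNormedModType R[i]).
Context (ip : {dot H for (@Num.conj R[i])}) (hH : induces_norm ip).
Implicit Types (x y z : H) (a b : R[i]) (M : set H).

(** The infimum is taken in [R] over real parts of the distances and then embedded in [R[i]]. *)
Lemma distance_attained_approx M h : M !=set0 -> exists d : R[i],
  [/\ 0 <= d, forall m, M m -> d <= `|h - m| &
      forall e, 0 < e -> exists2 m, M m & `|h - m| < d + e].
Proof.
move=> [m0 Mm0]; pose E := [set complex.Re `|h - m| | m in M].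
have nE m : (complex.Re `|h - m|)%:C%C = `|h - m|.
  by apply: RRe_real; exact: normr_real.
have E0 : lbound E 0 by move=> _ [m _ <-]; rewrite -ler0c nE.
have hE : has_inf E by split; [exists (complex.Re `|h - m0|); exists m0 | exists 0].
exists (inf E)%:C%C; split.
- by rewrite ler0c; apply: lb_le_inf; case: hE.
- by move=> m Mm; rewrite -nE lecR; apply: ge_inf; [case: hE | exists m].
move=> e e0; have eE : (complex.Re e)%:C%C = e.
  by apply: RRe_real; exact: gtr0_real.
have [|_ [m Mm <-] hm] := @inf_adherent _ E (complex.Re e) _ hE.
  by rewrite -ltcR eE.
by exists m => //; rewrite -eE -nE -rmorphD ltcR.
Qed.

Lemma projection M h : linear_subspace M -> banach_on M (fun x => `|x|) ->
  exists2 m, M m & forall v, M v -> ip (h - m) v = 0.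
Proof.
move=> [M0 Mlin] cM.
have [|d [d0 dle dap]] := @distance_attained_approx M h; first by exists 0.
have [u hu] : {u : nat -> H & forall n, M (u n) /\ `|h - u n| < d + 2%:R ^- n}.
  apply: (@choice _ _ (fun n x => M x /\ `|h - x| < d + 2%:R ^- n)) => n.
  by have [|m] := dap (2%:R ^- n); [rewrite invr_gt0 exprn_gt0 | exists m].
have Mhalf x y : M x -> M y -> M (2%:R^-1 *: (x + y)).
  move=> Mx My; have := Mlin 2%:R^-1 (x + y) 0; rewrite addr0; apply => //.
  by have := Mlin 1 x y; rewrite scale1r; apply.
have [m Mm um] : exists2 x, M x & forall e : R[i], 0 < e ->
       exists n0, forall n, (n0 <= n)%N -> `|u n - x| < e.
  apply: cM => [n|e e0]; first by have [] := hu n.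
  (* The parallelogram law will bound [|u i - u j|^2] by [4 (d + t)^2 - 4 d^2 = 8 d t + 4 t^2],
     which is at most [t (8 d + 4)] for [0 <= t <= 1]. *)
  have c0 : 0 < 8%:R * d + 4%:R by rewrite ltr_wpDl // mulr_ge0.
  have [|n0 hn0] := @complex_pow2_lt R (e ^+ 2 / (8%:R * d + 4%:R)).
    by rewrite divr_gt0 ?exprn_gt0.
  exists n0 => i j hi hj.
  rewrite -(@ltr_pXn2r _ 2) ?nnegrE ?(ltW e0) //.
  rewrite ltr_pdivlMr // in hn0; apply: le_lt_trans hn0.
  set t := 2%:R ^- n0.
  have t0 : 0 <= t by rewrite invr_ge0 exprn_ge0.
  have t1 : t <= 1 by have := @pow2_le R 0 n0 isT; rewrite expr0 invr1.
  have close k : (n0 <= k)%N -> `|h - u k| ^+ 2 <= (d + t) ^+ 2.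
    move=> hk; rewrite ler_pXn2r ?nnegrE ?addr_ge0 //.
    apply/ltW/(lt_le_trans (hu k).2); rewrite lerD2l; exact: pow2_le.
  (* The midpoint of [u i] and [u j] lies in [M], hence is at distance at least [d] from [h]. *)
  have far : 4%:R * d ^+ 2 <= `|(h - u i) + (h - u j)| ^+ 2.
    have -> : (h - u i) + (h - u j) = 2%:R *: (h - 2%:R^-1 *: (u i + u j)).
      by rewrite scalerBr scalerA divff // scale1r scaler_nat mulr2n opprD addrACA.
    rewrite normrZ exprMn normr_nat -natrX ler_pM2l //.
    rewrite ler_pXn2r ?nnegrE //; apply: dle; apply: Mhalf; exact: (hu _).1.
  have := parallelogram hH (h - u i) (h - u j).
  have -> : h - u i - (h - u j) = u j - u i by rewrite opprB addrC addrA subrK.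
  rewrite distrC => par.
  have -> : `|u i - u j| ^+ 2 = 2%:R * `|h - u i| ^+ 2 + 2%:R * `|h - u j| ^+ 2
      - `|h - u i + (h - u j)| ^+ 2 by rewrite -par; ring.
  rewrite lerBlDr; apply: (@le_trans _ _ (4%:R * (d + t) ^+ 2)).
    have -> : 4%:R * (d + t) ^+ 2 = 2%:R * (d + t) ^+ 2 + 2%:R * (d + t) ^+ 2 by ring.
    by apply: lerD; rewrite ler_pM2l // close.
  apply: (@le_trans _ _ (t * (8%:R * d + 4%:R) + 4%:R * d ^+ 2)); last by rewrite lerD2l.
  rewrite -subr_ge0.
  have -> : t * (8%:R * d + 4%:R) + 4%:R * d ^+ 2 - 4%:R * (d + t) ^+ 2
    = 4%:R * (t * (1 - t)) by ring.
  by rewrite !mulr_ge0 // subr_ge0.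
have hm : `|h - m| <= d.
  apply/ler_addgt0Pr => e e0.
  have e2 : 0 < e / 2%:R by rewrite divr_gt0.
  have [n1 hn1] := um _ e2; have [n2 hn2] := complex_pow2_lt e2.
  set n := maxn n1 n2; have -> : h - m = (h - u n) + (u n - m) by rewrite addrA subrK.
  apply: (le_trans (ler_normD _ _)); rewrite [e]splitr addrA; apply: lerD.
    apply/ltW/(lt_le_trans (hu n).2); rewrite lerD2l; apply/ltW/le_lt_trans/hn2.
    by apply: pow2_le; rewrite leq_maxr.
  by apply/ltW/hn1; rewrite leq_maxl.
exists m => // v Mv; have [->|v0] := eqVneq v 0; first exact: ip0r.
(* Removing the component along [v] lowers the squared distance by [|ip (h - m) v|^2 / |v|^2], yet
   [m + a v] is still in [M]; minimality makes this decrease vanish. *)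
set a := ip (h - m) v / `|v| ^+ 2.
have : d ^+ 2 <= `|(h - m) - a *: v| ^+ 2.
  rewrite ler_pXn2r ?nnegrE // -addrA -opprD; apply: dle; rewrite addrC; exact: Mlin.
rewrite sqr_norm_proj // => h1.
have h2 : `|h - m| ^+ 2 <= d ^+ 2 by rewrite ler_pXn2r ?nnegrE.
have := le_trans h2 h1.
rewrite lerBrDr -lerBrDl subrr pmulr_lle0 ?invr_gt0 ?exprn_gt0 ?normr_gt0 //.
by rewrite -normrX normr_le0 expf_eq0 /= => /eqP.
Qed.

Definition bounded_linear (f : H -> R[i]) := linear_on setT f /\ bounded_on setT (fun x => `|x|) f.

(** Unless [f] is zero, some [n] with [f n] nonzero is orthogonal to the kernel, which is complete.
    Each [f x n - f n x] lies in the kernel, and orthogonality to [n] gives [f x] as a multiple of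
    [ip x n]. *)
Lemma riesz f : bounded_linear f -> exists k, forall x, f x = ip x k.
Proof.
move=> [flin [c fc]].
have fD a x y : f (a *: x + y) = a * f x + f y by exact: flin.
have f0 : f 0 = 0.
  by have := fD (-1) 0 0; rewrite scaler0 addr0 mulN1r addNr.
(* The given bound [c] is an arbitrary element of [R[i]]; [|c| + 1] is a positive real that also
   works. *)
have fc' x : `|f x| <= (`|c| + 1) * `|x|.
  have := fc x I => h; apply: (@le_trans _ _ (`|c| * `|x|)).
    by rewrite -(normr_id x) -normrM ger0_norm // (le_trans _ h).
  by rewrite ler_wpM2r // lerDl.
have c0 : 0 < `|c| + 1 by rewrite ltr_wpDl.
have [f00|] := pselect (forall x, f x = 0).
  by exists 0 => x; rewrite ip0r.
move=> /existsNP [x0 /eqP fx0].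
have [m fm hm] : exists2 m, f m = 0 & forall v, f v = 0 -> ip (x0 - m) v = 0.
  apply: (@projection [set x | f x = 0]) => [|u fu cu].
    by split=> //= a x y fx fy; rewrite fD fx fy mulr0 addr0.
  have [x _ hx] := banach_on_setT (fun n => I) cu.
  exists x => //=; apply/eqP; rewrite -normr_le0; apply/ler_addgt0Pr => e e0.
  have [|n0 hn0] := hx (e / (`|c| + 1)); first by rewrite divr_gt0.
  have -> : f x = - f (u n0 - x).
    have := fD (-1) x (u n0); rewrite scaleN1r [- x + _]addrC => ->.
    by rewrite (fu n0) addr0 mulN1r opprK.
  rewrite normrN add0r (le_trans (fc' _)) // mulrC -ler_pdivlMr //.
  exact/ltW/hn0.
set n := x0 - m.
have fn : f n = f x0.
  have := fD (-1) m x0; rewrite scaleN1r [- m + _]addrC => ->.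
  by rewrite fm mulr0 add0r.
have n0 : ip n n != 0.
  by apply/eqP => /(ip_self_eq0 hH) nE; move: fx0; rewrite -fn nE f0 eqxx.
exists ((f x0 / ip n n)^* *: n) => x.
rewrite ipZr conjCK.
have : ip n (f x *: n - f n *: x) = 0.
  apply: hm; have := fD (- f n) x (f x *: n); rewrite scaleNr [- _ + _]addrC => ->.
  by have := fD (f x) n 0; rewrite !addr0 => ->; rewrite f0 addr0; ring.
move=> /(congr1 Num.conj); rewrite conjC0 -ipC ipBl !ipZl => /eqP.
rewrite subr_eq0 fn => /eqP h; rewrite mulrAC -h; by field.
Qed.
End Projection.

(** * Closed graph theorem for two complete norms on a subspace *)

Section EquivalentBanachNorms.
Context (R : realType) (H : completeNormedModType R[i]).
Implicit Types (x y z : H) (a e r : R[i]) (D : set H) (N : H -> R[i]).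

Lemma pos_lower_bound a e : 0 < a -> 0 < e -> exists r, [/\ 0 < r, r <= a & r <= e].
Proof.
move=> a0 e0; have [ae|ea] := real_leP (gtr0_real a0) (gtr0_real e0).
  by exists a.
by exists e; split => //; exact: ltW.
Qed.

Section Subspace.
Variables (D : set H) (hD : linear_subspace D).

Lemma subspaceZ a x : D x -> D (a *: x).
Proof. by move=> Dx; have := hD.2 a x 0 Dx hD.1; rewrite addr0. Qed.

Lemma subspaceD x y : D x -> D y -> D (x + y).
Proof. by move=> Dx Dy; have := hD.2 1 x y Dx Dy; rewrite scale1r. Qed.

Lemma subspaceB x y : D x -> D y -> D (x - y).
Proof. by move=> Dx Dy; apply: subspaceD => //; rewrite -scaleN1r; exact: subspaceZ. Qed.

Variables (N : H -> R[i]) (hN : norm_on D N).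

Lemma norm_on_ge0 x : D x -> 0 <= N x.
Proof. by case: hN => h _ _ _; exact: h. Qed.

Lemma norm_onD x y : D x -> D y -> N (x + y) <= N x + N y.
Proof. by case: hN => _ _ _; apply. Qed.

Lemma norm_onZ a x : D x -> N (a *: x) = `|a| * N x.
Proof. by case: hN => _ _ h _; exact: h. Qed.

Lemma norm_on_eq0 x : D x -> N x = 0 -> x = 0.
Proof. by case: hN => _ h _ _; exact: h. Qed.

Lemma norm_on0 : N 0 = 0.
Proof. by rewrite -(scale0r 0) norm_onZ ?normr0 ?mul0r //; exact: hD.1. Qed.

Lemma norm_onN x : D x -> N (- x) = N x.
Proof. by move=> Dx; rewrite -scaleN1r norm_onZ // normrN1 mul1r. Qed.

Lemma norm_onB x y : D x -> D y -> N (x - y) <= N x + N y.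
Proof.
move=> Dx Dy; rewrite -(norm_onN Dy); apply: norm_onD => //.
by rewrite -scaleN1r; exact: subspaceZ.
Qed.

Lemma norm_on_distC x y : D x -> D y -> N (x - y) = N (y - x).
Proof. by move=> Dx Dy; rewrite -norm_onN ?opprB //; exact: subspaceB. Qed.

Lemma norm_on_triangle z x y : D x -> D y -> D z -> N (x - y) <= N (x - z) + N (z - y).
Proof.
move=> Dx Dy Dz; have -> : x - y = (x - z) + (z - y) by rewrite addrA subrK.
by apply: norm_onD; exact: subspaceB.
Qed.

(** The fourth premise nests the closed balls with centre [u n] and radius [r n], so the limit lies
    in all of them. This serves Baire's shrinking balls as well as the partial sums of a geometric
    series of corrections. *)
Lemma nested_limit (u : nat -> H) (r : nat -> R[i]) :
  banach_on D N -> (forall n, D (u n)) -> (forall n, 0 <= r n) ->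
  (forall n, N (u n.+1 - u n) + r n.+1 <= r n) ->
  (forall e, 0 < e -> exists n, r n < e) ->
  exists2 z, D z & forall n, N (u n - z) <= r n.
Proof.
move=> cN Du r0 hu r_small.
have dist n k : N (u (n + k)%N - u n) + r (n + k)%N <= r n.
  elim: k => [|k IHk]; first by rewrite addn0 subrr norm_on0 add0r.
  apply: le_trans IHk; rewrite addnS.
  apply: (@le_trans _ _ (N (u (n + k)%N - u n) + (N (u (n + k).+1 - u (n + k)%N) + r (n + k).+1))).
    rewrite addrA lerD2r addrC; exact: norm_on_triangle.
  by rewrite lerD2l.
have dist' n m : (n <= m)%N -> N (u m - u n) <= r n.
  move=> nm; rewrite -(subnKC nm); apply: le_trans (dist n (m - n)%N).
  by rewrite lerDl.
have [e e0|z Dz uz] := cN u Du.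
  have e2 : 0 < e / 2%:R by rewrite divr_gt0.
  have [n hn] := r_small _ e2; exists n => i j hi hj.
  apply: (le_lt_trans (norm_on_triangle (Du i) (Du j) (Du n))).
  rewrite [e]splitr; apply: ltrD; first exact: le_lt_trans (dist' _ _ hi) hn.
  by rewrite norm_on_distC //; exact: le_lt_trans (dist' _ _ hj) hn.
exists z => // n; apply/ler_addgt0Pr => e e0.
have [n0 hn0] := uz e e0; set m := maxn n n0.
apply: (le_trans (norm_on_triangle (Du n) Dz (Du m))).
apply: lerD; first by rewrite norm_on_distC // dist' // leq_maxl.
by apply/ltW/hn0; rewrite leq_maxr.
Qed.

End Subspace.

Section TwoNorms.
Variables (D : set H) (hD : linear_subspace D) (N1 N2 : H -> R[i]).
Hypotheses (hN1 : norm_on D N1) (hN2 : norm_on D N2).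
Hypotheses (cN1 : banach_on D N1) (cN2 : banach_on D N2).

(** [D] is the union of the [N1]-balls of integer radius, so by Baire one of them is [N2]-dense in
    some [N2]-ball. Otherwise shrinking [N2]-balls can be chosen, the [n]-th choice avoiding the
    [N1]-ball of radius [n]; their common point would have an [N1]-norm above every integer. *)
Let baire_ball : exists n x0 r, [/\ D x0, 0 < r &
  forall x, D x -> N2 (x - x0) < r -> forall e, 0 < e ->
    exists2 y, D y & N1 y <= n%:R /\ N2 (x - y) < e].
Proof.
apply: contrapT => hneg.
(* Stating the invariant as a premise makes the step total, with [(0, 0)] as a dummy value, so that
   [choice] yields one function to iterate. *)
have step (n : nat) (s : H * R[i]) : exists s' : H * R[i], D s.1 /\ 0 < s.2 ->
   [/\ D s'.1, 0 < s'.2, N2 (s'.1 - s.1) + s'.2 <= s.2, s'.2 <= s.2 / 2%:R &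
     forall y, D y -> N1 y <= n%:R -> s'.2 < N2 (s'.1 - y)].
  case: s => x0 r /=.
  have [[Dx0 r0]|] := pselect (D x0 /\ 0 < r); last by exists (0, 0).
  have r2 : 0 < r / 2%:R by rewrite divr_gt0.
  have [x [Dx xx0 [e e0 he]]] : exists x, [/\ D x, N2 (x - x0) < r / 2%:R &
      exists2 e, 0 < e & forall y, D y -> N1 y <= n%:R -> e <= N2 (x - y)].
    apply: contrapT => hx; apply: hneg; exists n, x0, (r / 2%:R); split=> // x Dx xx0 e e0.
    apply: contrapT => hy; apply: hx; exists x; split=> //; exists e => // y Dy Ny.
    have N20 : 0 <= N2 (x - y) by apply: (norm_on_ge0 hN2); exact: (subspaceB hD).
    rewrite real_leNgt ?ger0_real ?(ltW e0) //.
    by apply/negP => xye; apply: hy; exists y.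
  have e2 : 0 < e / 2%:R by rewrite divr_gt0.
  have [r' [r'0 r'r r'e]] := pos_lower_bound r2 e2.
  exists (x, r') => _; split=> //=; first by rewrite [leRHS]splitr lerD // ltW.
  move=> y Dy Ny; apply: lt_le_trans (he y Dy Ny); apply: (le_lt_trans r'e).
  by rewrite ltr_pdivrMr // ltr_pMr // ltr1n.
have [F hF] := choice (fun ns : nat * (H * R[i]) => step ns.1 ns.2).
pose s n := iteri n (fun n s => F (n, s)) (0, 1).
have sok n : D (s n).1 /\ 0 < (s n).2.
  elim: n => [|n IHn] /=; first by split; [exact: hD.1 | exact: ltr01].
  by have [] := hF (n, s n) IHn.
have ss n := hF (n, s n) (sok n).
have s_small n : (s n).2 <= 1 / 2%:R ^+ n.
  elim: n => [|n IHn]; first by rewrite expr0 divr1.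
  have [_ _ _ h _] := ss n; apply: (le_trans h).
  by rewrite exprSr invfM mulrA ler_wpM2r // invr_ge0.
have [n|n|n|e e0|z Dz hz] := @nested_limit D hD N2 hN2 (fun n => (s n).1) (fun n => (s n).2) cN2.
- by case: (sok n).
- by case: (sok n) => _ /ltW.
- by case: (ss n).
- have [n hn] := complex_pow2_lt e0; exists n; apply: le_lt_trans hn.
  by have := s_small n; rewrite mul1r.
have [n hn] := complex_archi (norm_on_ge0 hN1 Dz).
have [_ _ _ _ h] := ss n.
have := lt_le_trans (h z Dz (ltW hn)) (hz n.+1).
by rewrite ltxx.
Qed.

Hypothesis compatible : forall (u : nat -> H) x y, (forall n, D (u n)) -> D x -> D y ->
  (forall e, 0 < e -> exists n0, forall n, (n0 <= n)%N -> N1 (u n - x) < e) ->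
  (forall e, 0 < e -> exists n0, forall n, (n0 <= n)%N -> N2 (u n - y) < e) -> x = y.

(** [compatible] says that the identity from [(D, N2)] to [(D, N1)] has a closed graph. The Baire
    ball is recentred at the origin by differences and rescaled; every small vector is then a sum of
    corrections whose [N1]-norms decrease geometrically. *)
Lemma banach_norm_dominated : exists2 C, 0 < C & forall x, D x -> N1 x <= C * N2 x.
Proof.
have [n [x0 [r [Dx0 r0 hball]]]] := baire_ball.
(* A difference of two vectors of the [N1]-ball of radius [n] has norm at most [2 n]; the added 1
   keeps [K] positive when [n = 0]. *)
pose K : R[i] := n%:R + n%:R + 1; have K0 : 0 < K by rewrite ltr_wpDl // addr_ge0.
have dense0 x : D x -> N2 x < r -> forall e, 0 < e ->
    exists2 y, D y & N1 y <= K /\ N2 (x - y) < e.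
  move=> Dx xr e e0; have e2 : 0 < e / 2%:R by rewrite divr_gt0.
  have [||y1 Dy1 [Ny1 xy1]] := hball (x0 + x) _ _ _ e2.
  - exact: subspaceD.
  - by rewrite addrAC subrr add0r.
  have [||y2 Dy2 [Ny2 xy2]] := hball x0 _ _ _ e2 => //.
    by rewrite subrr (norm_on0 hD hN2).
  exists (y1 - y2); first exact: subspaceB; split.
    apply: (le_trans (norm_onB hD hN1 Dy1 Dy2)).
    by apply: (le_trans (lerD Ny1 Ny2)); rewrite lerDl.
  have -> : x - (y1 - y2) = (x0 + x - y1) - (x0 - y2).
    by rewrite -[x0 + x - y1]addrA [x0 + (x - y1)]addrC addrKA opprK opprB addrA addrAC.
  have Dxy : D (x0 + x - y1) by apply: subspaceB => //; exact: subspaceD.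
  apply: (le_lt_trans (norm_onB hD hN2 Dxy (subspaceB hD Dx0 Dy2))).
  by rewrite [e]splitr ltrD.
have denseZ t x : 0 < t -> D x -> N2 x < t * r -> forall e, 0 < e ->
    exists2 y, D y & N1 y <= t * K /\ N2 (x - y) < e.
  move=> t0 Dx xr e e0.
  have tu : t != 0 by rewrite gt_eqF.
  have ti : 0 < 1 / t by rewrite divr_gt0.
  have [|||y Dy [Ny xy]] := dense0 ((1 / t) *: x) _ _ (e / t).
  - exact: subspaceZ.
  - by rewrite (norm_onZ hN2) // gtr0_norm // mul1r mulrC ltr_pdivrMr // mulrC.
  - by rewrite divr_gt0.
  exists (t *: y); first exact: subspaceZ.
  split; first by rewrite (norm_onZ hN1) // gtr0_norm // ler_pM2l.
  have -> : x - t *: y = t *: ((1 / t) *: x - y) by rewrite scalerBr scalerA mul1r divff // scale1r.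
  rewrite (norm_onZ hN2); last by apply: subspaceB => //; exact: subspaceZ.
  by rewrite gtr0_norm // mulrC -ltr_pdivlMr.
have p0 k : 0 < 2%:R ^- k :> R[i] by rewrite invr_gt0 exprn_gt0.
have main x : D x -> N2 x < r -> N1 x <= 2%:R * K.
  move=> Dx xr.
  have step (k : nat) y : exists y', D y -> N2 y < 2%:R ^- k * r ->
    [/\ D y', N1 (y - y') <= 2%:R ^- k * K & N2 y' < 2%:R ^- k.+1 * r].
    have [[Dy Ny]|hy] := pselect (D y /\ N2 y < 2%:R ^- k * r).
      have [|y0 Dy0 [h1 h2]] := denseZ _ _ (p0 k) Dy Ny (2%:R ^- k.+1 * r).
        by rewrite mulr_gt0.
      exists (y - y0) => _ _; split => //; first exact: subspaceB.
      by rewrite opprB addrC subrK.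
    by exists 0 => Dy Ny; case: hy.
  have [F hF] := choice (fun ky : nat * H => step ky.1 ky.2).
  (* [u n] is the remainder after [n] corrections. The partial sums [x - u n] converge in [N1], with
     tails [2^-n (2 K)], and in [N2] to [x]; [compatible] identifies the two limits. *)
  pose u n := iteri n (fun n y => F (n, y)) x.
  have uok k : D (u k) /\ N2 (u k) < 2%:R ^- k * r.
    elim: k => [|k [IH1 IH2]] /=; first by rewrite expr0 invr1 mul1r.
    by have [] := hF (k, u k) IH1 IH2.
  have us k := hF (k, u k) (uok k).1 (uok k).2.
  have [k|k|k|e e0|z Dz hz] := @nested_limit D hD N1 hN1 (fun n => x - u n)
    (fun n => 2%:R ^- n * (2%:R * K)) cN1.
  - by apply: subspaceB => //; case: (uok k).
  - by rewrite mulr_ge0 ?(ltW (p0 _)) // mulr_ge0 // ltW.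
  - have [_ h _] := us k.
    have -> : x - u k.+1 - (x - u k) = u k - u k.+1.
      by rewrite opprB addrC addrA subrK.
    have -> : 2%:R ^- k * (2%:R * K) = 2%:R ^- k * K + 2%:R ^- k.+1 * (2%:R * K).
      rewrite exprS invfM; field. by rewrite expf_neq0.
    by rewrite lerD2r.
  - have [|k hk] := @complex_pow2_lt R (e / (2%:R * K)); first by rewrite divr_gt0 // mulr_gt0.
    by exists k; rewrite -ltr_pdivlMr // mulr_gt0.
  have zx : z = x.
    apply: (@compatible (fun n => x - u n)) => //.
    - by move=> k; apply: subspaceB => //; case: (uok k).
    - move=> e e0; have [|k hk] := @complex_pow2_lt R (e / (2%:R * K)).
        by rewrite divr_gt0 // mulr_gt0.
      exists k => m km; apply: (le_lt_trans (hz m)); rewrite -ltr_pdivlMr ?mulr_gt0 //.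
      by apply: le_lt_trans hk; exact: pow2_le.
    move=> e e0; have [|k hk] := @complex_pow2_lt R (e / r); first by rewrite divr_gt0.
    exists k => m km; have [Dm hm] := uok m.
    rewrite addrAC subrr add0r (norm_onN hN2) //; apply: (lt_trans hm).
    by rewrite -ltr_pdivlMr //; apply: le_lt_trans hk; exact: pow2_le.
  have := hz 0%N; rewrite /u /= subrr zx add0r (norm_onN hN1) //.
  by rewrite expr0 invr1 mul1r.
have C0 : 0 < 2%:R * (2%:R * K) / r by rewrite divr_gt0 // !mulr_gt0.
exists (2%:R * (2%:R * K) / r) => // x Dx.
have [->|x0'] := eqVneq x 0.
  by rewrite (norm_on0 hD hN1) (norm_on0 hD hN2) mulr0.
have Nx : 0 < N2 x.
  rewrite lt_neqAle (norm_on_ge0 hN2) // andbT eq_sym.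
  by apply: contra_neq x0' => /(norm_on_eq0 hN2 Dx).
(* This scaling gives [t x] the [N2]-norm [r / 2], strictly inside the ball covered by [main]. *)
pose t := r / (2%:R * N2 x); have t0 : 0 < t by rewrite divr_gt0 // mulr_gt0.
have Nu : N2 x != 0 by rewrite gt_eqF.
have ru : r != 0 by rewrite gt_eqF.
have := main (t *: x) (subspaceZ hD _ Dx); rewrite (norm_onZ hN1) // (norm_onZ hN2) // gtr0_norm //.
have -> : t * N2 x = r / 2%:R by rewrite /t; field.
rewrite ltr_pdivrMr // ltr_pMr // ltr1n => /(_ isT).
rewrite -ler_pdivlMl // => /le_trans; apply.
rewrite le_eqVlt; apply/orP; left; apply/eqP; rewrite /t; field.
by rewrite Nu ru.
Qed.

End TwoNorms.
End EquivalentBanachNorms.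
Local Open Scope relation_scope.

(** * Positive self-adjoint relations and the range of 1 + B *)

Section PositiveSelfadjoint.
Context (R : realType) (H : completeNormedModType R[i]).
Context (ip : {dot H for (@Num.conj R[i])}) (hH : induces_norm ip).
Implicit Types (x y z : H) (a : R[i]) (A B C : set (H * H)).

Definition linear_relation A :=
  A (0, 0) /\ forall a x x' y y', A (x, x') -> A (y, y') -> A (a *: x + y, a *: x' + y').

Definition closed_relation A := forall (u v : nat -> H) x y,
  (forall n, A (u n, v n)) ->
  (forall e : R[i], 0 < e -> exists n0, forall n, (n0 <= n)%N -> `|u n - x| < e) ->
  (forall e : R[i], 0 < e -> exists n0, forall n, (n0 <= n)%N -> `|v n - y| < e) ->
  A (x, y).

Lemma linear_relationD A x x' y y' : linear_relation A ->
  A (x, x') -> A (y, y') -> A (x + y, x' + y').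
Proof. by move=> [_ h] Ax Ay; have := h 1 _ _ _ _ Ax Ay; rewrite !scale1r. Qed.

Lemma linear_relationZ A a x x' : linear_relation A -> A (x, x') -> A (a *: x, a *: x').
Proof. by move=> [h0 h] Ax; have := h a _ _ _ _ Ax h0; rewrite !addr0. Qed.

Lemma linear_relationB A x x' y y' : linear_relation A ->
  A (x, x') -> A (y, y') -> A (x - y, x' - y').
Proof.
move=> lA Ax /(linear_relationZ (-1) lA); rewrite !scaleN1r.
exact: linear_relationD.
Qed.

Lemma linear_relation_comp A B : linear_relation A -> linear_relation B ->
  linear_relation (A \; B).
Proof.
move=> [A0 lA] [B0 lB]; split; first by exists 0.
move=> a x x' y y' [s /= s1 s2] [t /= t1 t2].
by exists (a *: s + t) => /=; [exact: lB | exact: lA].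
Qed.

(** An adjoint is cut out by linear and continuous equations on pairs, so linearity and closedness
    hold for every relation [A]; self-adjoint relations inherit both. *)
Lemma adj_linear A : linear_relation (adj ip A).
Proof.
split=> [q _|a x x' y y' hx hy q Aq] /=; first by rewrite !ip0r.
by rewrite !ipE; rewrite (hx _ Aq) (hy _ Aq).
Qed.

Lemma adj_closed A : closed_relation (adj ip A).
Proof.
move=> u v x y huv hu hv [p q] Apq /=; apply/eqP; rewrite -subr_eq0 -normr_le0.
apply/ler_addgt0Pr => e e0; rewrite add0r.
pose c := `|p| + `|q| + 1; have c0 : 0 < c by rewrite ltr_wpDl ?addr_ge0.
have ec : 0 < e / c by rewrite divr_gt0.
have [n1 hn1] := hu _ ec; have [n2 hn2] := hv _ ec.
set n := maxn n1 n2.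
have -> : ip q x - ip p y = ip p (v n - y) - ip q (u n - x).
  by rewrite !ipBr -(huv n _ Apq) /=; ring.
apply: (le_trans (ler_normB _ _)).
apply: (@le_trans _ _ (`|p| * (e / c) + `|q| * (e / c))).
  apply: lerD; apply: (le_trans (ip_cauchy_schwarz hH _ _)); rewrite ler_wpM2l //.
    by apply/ltW/hn2; rewrite leq_maxr.
  by apply/ltW/hn1; rewrite leq_maxl.
rewrite -mulrDl mulrCA ger_pMr // ler_pdivrMr // mul1r.
by rewrite lerDl.
Qed.

Section Theory.
Variables (B : set (H * H)) (pB : positive_selfadjoint ip B).

Lemma psa_linear : linear_relation B.
Proof. by case: pB => _ <- _; exact: adj_linear. Qed.

Lemma psa_closed : closed_relation B.
Proof. by case: pB => _ <- _; exact: adj_closed. Qed.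

Lemma psa_sym x x' y y' : B (x, x') -> B (y, y') -> ip x' y = ip x y'.
Proof. by move=> Bx; case: pB => _ <- _ By; exact: (By _ Bx). Qed.

Lemma psa_maximal x x' : (forall y y', B (y, y') -> ip y' x = ip y x') -> B (x, x').
Proof. by move=> h; case: pB => _ <- _ [y y'] By; exact: h. Qed.

Lemma psa_ge0 x x' : B (x, x') -> 0 <= ip x' x.
Proof. by case: pB => _ _ h /h. Qed.

Lemma psa_dense_eq0 x : (forall y y', B (y, y') -> ip y x = 0) -> x = 0.
Proof.
case: pB => dB _ _ h; apply: (ip_dense_eq0 hH dB) => _ [[y y'] By <-].
exact: h By.
Qed.

Lemma psa_functional x y y' : B (x, y) -> B (x, y') -> y = y'.
Proof.
move=> By By'; apply/eqP; rewrite -subr_eq0; apply/eqP/psa_dense_eq0 => z z' Bz.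
by rewrite ipBr -(psa_sym Bz By) -(psa_sym Bz By') subrr.
Qed.

Lemma psa_appE x y : B (x, y) -> app B x = y.
Proof.
move=> By; apply: psa_functional (By).
by apply: (@xgetPex _ 0 [set z | B (x, z)]); exists y.
Qed.

Lemma psa_app x : dom B x -> B (x, app B x).
Proof. by case=> -[u v] Buv <- /=; rewrite (psa_appE Buv). Qed.

Lemma psa_app_linear a x y : dom B x -> dom B y ->
  app B (a *: x + y) = a *: app B x + app B y.
Proof.
by move=> /psa_app Bx /psa_app By; apply: psa_appE; apply: (proj2 psa_linear).
Qed.

Lemma psa_dom_subspace : linear_subspace (dom B).
Proof.
split=> [|a x y [[x0 x'] Bx <-] [[y0 y'] By <-]].
  by exists (0, 0) => //; exact: (proj1 psa_linear).
by exists (a *: x0 + y0, a *: x' + y') => //; exact: (proj2 psa_linear).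
Qed.

Lemma psa_sqr_norm x y : B (x, y) -> `|x| ^+ 2 + `|y| ^+ 2 <= `|x + y| ^+ 2.
Proof.
move=> Bxy; have h := psa_ge0 Bxy.
rewrite (sqr_norm_add hH) addrAC lerDl ipC geC0_conj // ?addr_ge0 //.
Qed.

Lemma psa_norm_dom x y : B (x, y) -> `|x| <= `|x + y|.
Proof.
move=> Bxy; rewrite -(@ler_pXn2r _ 2) ?nnegrE //.
by apply: le_trans (psa_sqr_norm Bxy); rewrite lerDl exprn_ge0.
Qed.

Lemma psa_norm_ran x y : B (x, y) -> `|y| <= `|x + y|.
Proof.
move=> Bxy; rewrite -(@ler_pXn2r _ 2) ?nnegrE //.
by apply: le_trans (psa_sqr_norm Bxy); rewrite lerDr exprn_ge0.
Qed.

(** The map from [x + y] to [x - y] is the Cayley transform of [B]; the squared norms differ by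
    [4 ip y x], which is nonnegative. *)
Lemma psa_cayley_contraction x y : B (x, y) -> `|x - y| <= `|x + y|.
Proof.
move=> Bxy; have h := psa_ge0 Bxy.
rewrite -(@ler_pXn2r _ 2) ?nnegrE // (sqr_norm_sub hH) (sqr_norm_add hH).
rewrite lerD2r lerD2l ipC geC0_conj // -subr_ge0 opprK.
by rewrite !addr_ge0.
Qed.

(** The range of [1 + B] is complete, because [|x| <= |x + B x|] and [B] is closed. A vector [n]
    orthogonal to it satisfies [B n = - n] by maximality, and positivity leaves only [n = 0]. *)
Lemma psa_resolvent_surj z : exists2 x, dom B x & B (x, z - x).
Proof.
pose M := [set z | exists2 x, dom B x & B (x, z - x)].
have [lB0 lB] := psa_linear.
have MS : linear_subspace M.
  split=> [|a s t [x _ Bx] [y _ By]]; first by exists 0; [exists (0, 0)|rewrite subr0].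
  have Bxy := lB a _ _ _ _ Bx By.
  exists (a *: x + y); first by exists (a *: x + y, a *: (s - x) + (t - y)).
  by rewrite opprD addrACA -scalerBr.
have Mc : banach_on M (fun x => `|x|).
  move=> w Mw cw.
  have [u hu] : {u : nat -> H & forall n, B (u n, w n - u n)}.
    by apply: (@choice _ _ (fun n x => B (x, w n - x))) => n; have [x _ Bx] := Mw n; exists x.
  have hB m n : B (u m - u n, (w m - w n) - (u m - u n)).
    have -> : w m - w n - (u m - u n) = (w m - u m) - (w n - u n).
      by rewrite opprD addrACA -opprD.
    exact: (linear_relationB psa_linear (hu m) (hu n)).
  have [z0 _ wz] := banach_on_setT (fun n => I) cw.
  have [x _ ux] : exists2 x, setT x & forall e : R[i], 0 < e ->
       exists n0, forall n, (n0 <= n)%N -> `|u n - x| < e.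
    apply: banach_on_setT => // e e0; have [n0 h] := cw e e0.
    exists n0 => m n hm hn; apply: le_lt_trans (h m n hm hn).
    by have := psa_norm_dom (hB m n); rewrite addrCA subrr addr0.
  have Bx : B (x, z0 - x).
    apply: (psa_closed hu ux) => e e0.
    have e2 : 0 < e / 2%:R by rewrite divr_gt0.
    have [n1 hn1] := wz _ e2; have [n2 hn2] := ux _ e2.
    exists (maxn n1 n2) => n; rewrite geq_max => /andP[h1 h2].
    have -> : w n - u n - (z0 - x) = (w n - z0) - (u n - x).
      by rewrite opprD addrACA -opprD.
    apply: (le_lt_trans (ler_normB _ _)); rewrite [e]splitr.
    by apply: ltrD; [exact: hn1 | exact: hn2].
  by exists z0 => //; exists x => //; exists (x, z0 - x).
have [m Mm hm] := projection hH z MS Mc.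
have zm : z = m; last by rewrite zm.
apply/eqP; rewrite -subr_eq0; apply/eqP; set n := z - m in hm *.
have Bn : B (n, - n).
  apply: psa_maximal => y y' By; apply/eqP; rewrite ipNr -addr_eq0 addrC; apply/eqP.
  rewrite -ipDl ipC hm ?conjC0 //.
  by exists y; [exists (y, y')|rewrite addrAC subrr add0r].
apply: (ip_self_eq0 hH); apply/eqP; rewrite eq_le -[in 0 <= _]hH exprn_ge0 // andbT.
by have := psa_ge0 Bn; rewrite ipNl oppr_ge0.
Qed.

End Theory.
End PositiveSelfadjoint.

(** * Uniqueness of positive self-adjoint square roots *)

Lemma bounded_convex_seq_eq0 (R : realType) (c : nat -> R[i]) (M : R[i]) :
  (forall n, 0 <= c n) -> (forall n, c n <= M) -> c 0%N = 0 ->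
  (forall n, 2%:R * c n.+1 <= c n + c n.+2) -> c 1%N = 0.
Proof.
move=> c_ge0 cM c0 hc.
(* Convexity makes the increments nondecreasing, so all are at least the first one, [c 1]. Hence
   [c n >= n c 1], which boundedness allows only for [c 1 = 0]. *)
have incr n : c n + c 1%N <= c n.+1.
  elim: n => [|n IHn]; first by rewrite c0 add0r.
  have := lerD (hc n) IHn.
  have -> : c n + c n.+2 + c n.+1 = c n.+2 + (c n + c n.+1) by ring.
  have -> : 2%:R * c n.+1 + (c n + c 1%N) = (c n.+1 + c 1%N) + (c n + c n.+1) by ring.
  by rewrite lerD2r.
have lin n : n%:R * c 1%N <= c n.
  elim: n => [|n IHn]; first by rewrite mul0r c0.
  by rewrite -natr1 mulrDl mul1r; apply: le_trans (incr n); rewrite lerD2r.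
apply/eqP; rewrite eq_le c_ge0 andbT real_leNgt ?ger0_real //.
apply/negP => c1.
have M0 : 0 <= M by apply: le_trans (c_ge0 0%N) (cM 0%N).
have [|n hn] := @complex_archi R (M / c 1%N); first by rewrite divr_ge0.
move: hn; rewrite ltr_pdivrMr // => /lt_le_trans/(_ (lin n))/lt_le_trans/(_ (cM n)).
by rewrite ltxx.
Qed.

Section SquareRoot.
Context (R : realType) (H : completeNormedModType R[i]).
Context (ip : {dot H for (@Num.conj R[i])}) (hH : induces_norm ip).
Implicit Types (x y z : H) (a : R[i]) (A B C : set (H * H)).

Section Resolvent.
Variables (B : set (H * H)) (pB : positive_selfadjoint ip B).

Lemma psa_resolvent : {J : H -> H | forall z, B (J z, z - J z)}.
Proof.
have [|J hJ] := @choice _ _ (fun z x => B (x, z - x)); last by exists J.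
by move=> z; have [x _ Bx] := psa_resolvent_surj hH pB z; exists x.
Qed.

Variables (J : H -> H) (hJ : forall z, B (J z, z - J z)).

Lemma resolventE x y : B (x, y) -> J (x + y) = x.
Proof.
move=> Bxy; have Bd := linear_relationB (psa_linear pB) (hJ (x + y)) Bxy.
have := psa_norm_dom hH pB Bd.
have -> : J (x + y) - x + (x + y - J (x + y) - y) = 0.
  by apply: (ip_injl hH) => z; rewrite !ipE; ring.
by rewrite normr0 normr_le0 subr_eq0 => /eqP.
Qed.

Lemma resolvent_linear a x y : J (a *: x + y) = a *: J x + J y.
Proof.
have := resolventE (proj2 (psa_linear pB) a _ _ _ _ (hJ x) (hJ y)).
congr (J _ = _); apply: (ip_injl hH) => z; rewrite !ipE; ring.
Qed.

Lemma resolvent_dom z : dom B (J z).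
Proof. by exists (J z, z - J z). Qed.

Lemma resolvent_norm z : `|J z| <= `|z|.
Proof. by have := psa_norm_dom hH pB (hJ z); rewrite addrCA subrr addr0. Qed.

Lemma resolvent_compl_norm z : `|z - J z| <= `|z|.
Proof. by have := psa_norm_ran hH pB (hJ z); rewrite addrCA subrr addr0. Qed.

(** [(1 - B)(1 + B)^-1] written through the resolvent, since [1 - B = 2 - (1 + B)]. *)
Definition cayley_step z := 2%:R *: J z - z.

Lemma cayley_step_norm z : `|cayley_step z| <= `|z|.
Proof.
have := psa_cayley_contraction hH pB (hJ z).
rewrite addrCA subrr addr0.
congr (`|_| <= _); apply: (ip_injl hH) => t; rewrite !ipE; ring.
Qed.

(** By construction [B] sends [w_n + w_(n+1) = 2 J w_n] to [w_n - w_(n+1)]. Adding this for [n] and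
    [n+1] gives the intermediate vector [w_n - w_(n+2)]; subtracting gives its image. *)
Lemma cayley_second_difference z (w := fun n => iter n cayley_step z) n :
  (B \; B) (w n + 2%:R *: w n.+1 + w n.+2, w n - 2%:R *: w n.+1 + w n.+2).
Proof.
have lB := psa_linear pB.
have B0 := linear_relationZ 2%:R lB (hJ (w n)).
have B1 := linear_relationZ 2%:R lB (hJ (w n.+1)).
exists (w n - w n.+2) => /=.
  have := linear_relationD lB B0 B1; congr (B (_, _)).
    by apply: (ip_injl hH) => t; rewrite /w /= /cayley_step !ipE; ring.
  by apply: (ip_injl hH) => t; rewrite /w /= /cayley_step !ipE; ring.
have := linear_relationB lB B0 B1; congr (B (_, _)).
  by apply: (ip_injl hH) => t; rewrite /w /= /cayley_step !ipE; ring.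
by apply: (ip_injl hH) => t; rewrite /w /= /cayley_step !ipE; ring.
Qed.

End Resolvent.

Lemma psa_comp_ge0 B x y : positive_selfadjoint ip B -> (B \; B) (x, y) -> 0 <= ip y x.
Proof.
move=> pB [z /= Bxz Bzy]; rewrite (psa_sym pB Bzy Bxz) -hH exprn_ge0 //.
Qed.

(** With [p = x + z], the real part of [ip (p - 2 y) (p + 2 y)] is [|p|^2 - 4 |y|^2]; adding the
    conjugate isolates it. *)
Lemma norm_convex_of_ge0 x y z :
  0 <= ip (x - 2%:R *: y + z) (x + 2%:R *: y + z) -> 2%:R * `|y| <= `|x| + `|z|.
Proof.
set p := x + z; have -> : x - 2%:R *: y + z = p - 2%:R *: y by rewrite addrAC.
have -> : x + 2%:R *: y + z = p + 2%:R *: y by rewrite addrAC.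
move=> h; apply: (le_trans _ (ler_normD x z)).
rewrite -(ler_pXn2r (n := 2)) ?nnegrE ?mulr_ge0 // -subr_ge0.
rewrite -(pmulr_rge0 _ (x := 2%:R)) //.
have := addr_ge0 h h; rewrite -{2}(geC0_conj h) -ipC; congr (_ <= _).
rewrite exprMn !hH -/p !ipE conjC_nat; ring.
Qed.

(* The powers [w_n] of the Cayley transform [(1 - B)(1 + B)^-1] applied to a
   vector satisfy the second-order recurrence
   [w_n - 2 w_(n+1) + w_(n+2) = B^2 (w_n + 2 w_(n+1) + w_(n+2))], which only
   involves [B^2] and, by positivity, has a single bounded solution for given
   [w_0]. *)
Lemma psa_sqrt_sub B C : positive_selfadjoint ip B -> positive_selfadjoint ip C ->
  B \; B = C \; C -> B `<=` C.
Proof.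
move=> pB pC BC [x y] Bxy.
have [J hJ] := psa_resolvent pB; have [K hK] := psa_resolvent pC.
pose z := x + y.
pose u n := iter n (cayley_step J) z; pose v n := iter n (cayley_step K) z.
have un n : `|u n| <= `|z|.
  by elim: n => // n IHn; apply: (le_trans (cayley_step_norm pB hJ _)).
have vn n : `|v n| <= `|z|.
  by elim: n => // n IHn; apply: (le_trans (cayley_step_norm pC hK _)).
have w1 : `|u 1%N - v 1%N| = 0.
  apply: (@bounded_convex_seq_eq0 R (fun n => `|u n - v n|) (2%:R * `|z|)) => //.
  - move=> n; apply: (le_trans (ler_normB _ _)).
    by rewrite mulr_natl mulr2n lerD.
  - by rewrite subrr normr0.
  move=> n; apply: norm_convex_of_ge0; apply: (psa_comp_ge0 pB).
  have hu := cayley_second_difference pB hJ z n.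
  have hv := cayley_second_difference pC hK z n; rewrite -BC in hv.
  have lB := psa_linear pB.
  have := linear_relationB (linear_relation_comp lB lB) hu hv.
  by congr ((B \; B) (_, _)); apply: (ip_injl hH) => t; rewrite !ipE; ring.
(* The Cayley transforms agree at [z], hence so do the resolvents; since [J z = x], the defining
   property of [K z] reads [C (x, y)]. *)
have JK : J z = K z.
  move/eqP: w1; rewrite normr_eq0 subr_eq0 /u /v /= => /eqP /addIr.
  by apply: scalerI; rewrite pnatr_eq0.
have Jx : J z = x by exact: (resolventE pB hJ Bxy).
by have := hK z; rewrite -JK Jx /z addrAC subrr add0r.
Qed.

Lemma psa_sqrt_unique B C : positive_selfadjoint ip B -> positive_selfadjoint ip C ->
  B \; B = C \; C -> B = C.
Proof. by move=> pB pC BC; apply/seteqP; split; apply: psa_sqrt_sub. Qed.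

(** The fallback value of [op_sqrt] is the empty relation, so a single element certifies a genuine
    square root. *)
Lemma op_sqrtP A : op_sqrt ip A !=set0 ->
  positive_selfadjoint ip (op_sqrt ip A) /\ op_sqrt ip A \; op_sqrt ip A = A.
Proof. by rewrite /op_sqrt; case: xgetP => [B -> []|_ []]. Qed.

Lemma op_sqrtE A B : positive_selfadjoint ip B -> B \; B = A -> op_sqrt ip A = B.
Proof.
move=> pB BA; have [pS SA] : positive_selfadjoint ip (op_sqrt ip A) /\
    op_sqrt ip A \; op_sqrt ip A = A.
  by apply: (@xgetPex _ set0 [set C | positive_selfadjoint ip C /\ C \; C = A]); exists B.
by apply: psa_sqrt_unique; rewrite ?BA.
Qed.

End SquareRoot.

(** * Partial isometries and conjugation by them *)

Section PartialIsometry.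
Context (R : realType) (H : completeNormedModType R[i]).
Context (ip : {dot H for (@Num.conj R[i])}) (hH : induces_norm ip).
Implicit Types (x y z : H) (a e : R[i]) (B : set (H * H)).
Variables (U : {linear H -> H}) (hU : partial_isometry ip U).

Lemma partial_isometry_adjoint : {V : H -> H | forall x y, ip (U x) y = ip x (V y)}.
Proof.
have [|V hV] := @choice _ _ (fun y k => forall x, ip (U x) y = ip x k); last by exists V.
move=> y; apply: (riesz hH (f := fun x => ip (U x) y)); split.
  by move=> a s t _ _; rewrite linearP !ipE.
have [[M hM] _] := hU; exists (M * `|y|) => x _.
apply: (le_trans (ip_cauchy_schwarz hH _ _)).
by rewrite mulrAC ler_wpM2r.
Qed.

Variables (V : H -> H) (hV : forall x y, ip (U x) y = ip x (V y)).

Lemma adjointC x y : ip (V x) y = ip x (U y).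
Proof. by rewrite ipC -hV -ipC. Qed.

Lemma adjointB x y : V (x - y) = V x - V y.
Proof. by apply: (ip_injl hH) => z; rewrite adjointC !ipE !adjointC. Qed.

Lemma adjointD x y : V (x + y) = V x + V y.
Proof. by apply: (ip_injl hH) => z; rewrite adjointC !ipE !adjointC. Qed.

Let ker_orthogonal x := forall k, U k = 0 -> ip x k = 0.

Lemma partial_isometry_ip x y : ker_orthogonal x -> ker_orthogonal y ->
  ip (U x) (U y) = ip x y.
Proof.
move=> hx hy.
have iso a : `|a *: U x + U y| ^+ 2 = `|a *: x + y| ^+ 2.
  rewrite -linearP; congr (_ ^+ 2); apply: hU.2 => k hk.
  by rewrite !ipE hx // hy // mulr0 addr0.
have eqx : ip (U x) (U x) = ip x x by rewrite -!hH hU.2.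
have eqy : ip (U y) (U y) = ip y y by rewrite -!hH hU.2.
(* Polarization: the factor 1 compares the sums of an inner product and its conjugate, the factor
   ['i] their differences. *)
have h1 := iso 1; have hi := iso 'i.
rewrite !hH !ipE eqx eqy in h1 hi.
rewrite conjC1 in h1; rewrite conjCi in hi.
have e1 : ip (U x) (U y) + ip (U y) (U x) = ip x y + ip y x.
  apply/eqP; rewrite -subr_eq0; apply/eqP.
  by move/eqP: h1; rewrite -subr_eq0 => /eqP h1; etransitivity; [|exact: h1]; ring.
have e2 : 'i * (ip (U x) (U y) - ip (U y) (U x)) = 'i * (ip x y - ip y x).
  apply/eqP; rewrite -subr_eq0; apply/eqP.
  by move/eqP: hi; rewrite -subr_eq0 => /eqP hi; etransitivity; [|exact: hi]; ring.
have {}e2 := mulfI (neq0Ci _) e2.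
have : 2%:R * ip (U x) (U y) = 2%:R * ip x y.
  have -> : 2%:R * ip x y = (ip x y + ip y x) + (ip x y - ip y x) by ring.
  by rewrite -e1 -e2; ring.
by apply: mulfI; rewrite pnatr_eq0.
Qed.

(** A test vector splits along the kernel of [U]: its kernel part contributes to neither side, and
    on the orthogonal complement [U] preserves inner products. *)
Lemma adjoint_partial_isometryK x : ker_orthogonal x -> V (U x) = x.
Proof.
move=> hx.
have kerM : linear_subspace [set k | U k = 0].
  split=> [|a k l /= hk hl]; first exact: linear0.
  by rewrite linearP hk hl scaler0 addr0.
have kerC : banach_on [set k | U k = 0] (fun x => `|x|).
  have [[M hM] _] := hU => u hu cu.
  have [y _ uy] := banach_on_setT (fun n => I) cu; exists y => //=.
  apply: (ip_injl hH) => z; rewrite ip0l hV.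
  apply/eqP; rewrite -normr_le0; apply/ler_addgt0Pr => e e0; rewrite add0r.
  have c0 : 0 < `|V z| + 1 by rewrite ltr_wpDl.
  have [|n hn] := uy (e / (`|V z| + 1)); first by rewrite divr_gt0.
  have -> : ip y (V z) = - ip (u n - y) (V z).
    by rewrite ipBl -(hV (u n)) (hu n : U (u n) = 0) ip0l sub0r opprK.
  rewrite normrN; apply: (le_trans (ip_cauchy_schwarz hH _ _)).
  apply: (@le_trans _ _ (e / (`|V z| + 1) * (`|V z| + 1))).
    by apply: ler_pM => //; [apply/ltW/hn | rewrite lerDl].
  by rewrite divfK // gt_eqF.
apply: (ip_injl hH) => y; rewrite adjointC.
have [k hk hyk] := projection hH y kerM kerC.
have -> : y = k + (y - k) by rewrite addrCA subrr addr0.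
by rewrite linearD [U k]hk add0r partial_isometry_ip // [in RHS]ipDr [ip x k]hx // add0r.
Qed.

Lemma adjoint_ker_orthogonal x : ker_orthogonal (V x).
Proof. by move=> k hk; rewrite adjointC hk ip0r. Qed.

Lemma adjointKK x : V (U (V x)) = V x.
Proof. apply: adjoint_partial_isometryK; exact: adjoint_ker_orthogonal. Qed.

Lemma partial_isometryKK x : U (V (U x)) = U x.
Proof. by apply: (ip_inj hH) => z; rewrite -adjointC -hV -adjointC adjointKK adjointC. Qed.

Lemma partial_isometry_contraction x : `|U x| <= `|x|.
Proof.
have [->|Ux0] := eqVneq (U x) 0; first by rewrite normr0.
have VU : `|V (U x)| = `|U x|.
  by rewrite -[in RHS]partial_isometryKK hU.2 //; exact: adjoint_ker_orthogonal.
have : `|U x| ^+ 2 <= `|x| * `|U x|.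
  rewrite -[`|U x| ^+ 2]ger0_norm ?exprn_ge0 // hH hV -VU.
  exact: ip_cauchy_schwarz.
by rewrite expr2 ler_pM2r // normr_gt0.
Qed.

(* The operator [U B V], where [V] is the adjoint of [U]. *)
Definition conjugate_relation B : set (H * H) :=
  [set p | exists2 v, B (V p.1, v) & p.2 = U v].

Section ConjugateRelation.
Variables (B : set (H * H)) (pB : positive_selfadjoint ip B).
Hypothesis kerB : forall k, U k = 0 -> B (k, 0).

(** By symmetry the range of [B] is orthogonal to the kernel of [B], hence to that of [U], where [V]
    inverts [U]. *)
Lemma psa_ran_ker_orthogonal x v : B (x, v) -> V (U v) = v.
Proof.
move=> Bxv; apply: adjoint_partial_isometryK => k hk.
by rewrite (psa_sym pB Bxv (kerB hk)) ip0r.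
Qed.

Lemma psa_proj x v : B (x, v) <-> B (V (U x), v).
Proof.
have hk : U (x - V (U x)) = 0 by rewrite linearB partial_isometryKK subrr.
have lB := psa_linear pB; split=> Bx.
  by have := linear_relationB lB Bx (kerB hk); rewrite opprB addrCA subrr addr0 subr0.
by have := linear_relationD lB Bx (kerB hk); rewrite addrCA subrr !addr0.
Qed.

Lemma conjugate_relation_comp :
  conjugate_relation B \; conjugate_relation B = conjugate_relation (B \; B).
Proof.
apply/seteqP; split=> [[x y] [_ /= [v /= Bxv ->] [w /= Bvw ->]]|[x y] [w [v /= Bxv Bvw] /= ->]].
  exists w => //; exists v => //=.
  by rewrite -(psa_ran_ker_orthogonal Bxv).
exists (U v) => /=; first by exists v.
by exists w => //=; rewrite (psa_ran_ker_orthogonal Bxv).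
Qed.

Lemma conjugate_relation_psa : positive_selfadjoint ip (conjugate_relation B).
Proof.
have [dB _ _] := pB; split.
- apply/denseP => x e e0; have [d [[d0 v] /= Bd <-] xd] := (denseP _).1 dB (V x) e e0.
  (* This correction of [x] turns [V x] into [V (U d0)], which is in the domain of [B] along with
     [d0]; it is small because [U] is a contraction. *)
  exists (x + U (d0 - V x)).
    exists (x + U (d0 - V x), U v) => //; exists v => //=.
    have -> : V (x + U (d0 - V x)) = V (U d0).
      by rewrite linearB adjointD adjointB adjointKK addrCA subrr addr0.
    exact: (psa_proj d0 v).1 Bd.
  rewrite opprD addNKr normrN; apply: (le_lt_trans (partial_isometry_contraction _)).
  by rewrite distrC.
- apply/seteqP; split=> [[x y] hxy|[x y] [v /= Bv ->] [z w] [t /= Bt ->]].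
    (* The relation contains [(k, 0)] whenever [V k = 0], so [y] is orthogonal to the kernel of [V],
       in particular to [y - U (V y)]. *)
    have yE : y = U (V y).
      apply/eqP; rewrite -subr_eq0; apply/eqP/(ip_self_eq0 hH); set k := y - U (V y).
      have Vk : V k = 0 by rewrite adjointB adjointKK subrr.
      have := hxy (k, 0); rewrite ip0l /= => /(_ _)/esym; rewrite ipBr -/k.
      rewrite -[ip k (U _)]adjointC Vk ip0l subr0; apply.
      by exists 0; rewrite /= ?linear0 // Vk; exact: (proj1 (psa_linear pB)).
    exists (V y) => //=; apply: (psa_maximal pB) => d d' Bd.
    rewrite -!hV; have := hxy (U d, U d'); apply.
    by exists d' => //=; exact: (psa_proj d d').1 Bd.
  by rewrite hV (psa_sym pB Bt Bv) adjointC.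
- by move=> [x y] [v /= Bv ->]; rewrite hV; exact: (psa_ge0 pB Bv).
Qed.
End ConjugateRelation.

End PartialIsometry.

(** * Adjoint and moduli computed from the polar decomposition *)

Lemma graph_compE (R : realType) (H : completeNormedModType R[i]) (U : H -> H) (A : set (H * H)) :
  graph U \; A = [set p | exists2 v, A (p.1, v) & p.2 = U v].
Proof. by []. Qed.

Lemma comp_graphE (R : realType) (H : completeNormedModType R[i]) (U : H -> H) (A : set (H * H)) :
  A \; graph U = [set p | A (U p.1, p.2)].
Proof.
apply/seteqP; split=> [[x y] [z /= zE Az]|[x y] /= Axy]; last by exists (U x).
by rewrite /graph /= in zE; rewrite -zE.
Qed.

Section PolarDecomposition.
Context (R : realType) (H : completeNormedModType R[i]).
Context (ip : {dot H for (@Num.conj R[i])}) (hH : induces_norm ip).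
Implicit Types (x y z : H) (a e : R[i]) (B : set (H * H)).
Variables (T : set (H * H)) (U : {linear H -> H}) (P : set (H * H)).
Hypotheses (hU : partial_isometry ip U) (pP : positive_selfadjoint ip P).
Hypotheses (PP : P \; P = adj ip T \; T) (TE : T = graph U \; P).
Hypothesis kerT : forall x, U x = 0 <-> T (x, 0).

(** The decomposition ties the kernel of [U] to that of [T], while conjugation by [U] needs it
    inside that of [P]. For [p = P k] one has [U p = 0], so [T p = 0] and [P (P p) = 0]; symmetry of
    [P] gives [P p = 0], then [p = 0]. *)
Lemma polar_ker k : U k = 0 -> P (k, 0).
Proof.
move=> hk; have [p Pkp /= Up] : (graph U \; P) (k, 0) by rewrite -TE; exact/kerT.
have Tp : T (p, 0) by apply/kerT.
have [q /= Ppq Pq0] : (P \; P) (p, 0).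
  by rewrite PP; exists 0 => //; exact: (proj1 (adj_linear ip T)).
have q0 : q = 0 by apply: (ip_self_eq0 hH); rewrite (psa_sym pP Ppq Pq0) ip0r.
rewrite q0 in Ppq.
have p0 : p = 0 by apply: (ip_self_eq0 hH); rewrite (psa_sym pP Pkp Ppq) ip0r.
by rewrite p0 in Pkp.
Qed.

Variables (V : H -> H) (hV : forall x y, ip (U x) y = ip x (V y)).

Lemma polar_adj : adj ip T = [set p | P (V p.1, p.2)].
Proof.
apply/seteqP; split=> [[x y] /= hxy|[x y] /= Pxy [z w]].
  apply: (psa_maximal pP) => z z' Pz; rewrite -hV.
  by apply: (hxy (z, U z')); rewrite TE; exists z'.
by rewrite TE graph_compE => -[z' /= Pz ->]; rewrite hV; exact: (psa_sym pP Pz Pxy).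
Qed.

Lemma polar_adj_adj : adj ip (adj ip T) = T.
Proof.
apply/seteqP; split=> [[x y] hxy|[x y] Txy q hq]; last first.
  by rewrite /= ipC -(hq _ Txy) -ipC.
have yE : y = U (V y).
  apply/eqP; rewrite -subr_eq0; apply/eqP/(ip_self_eq0 hH); set k := y - U (V y).
  have Vk : V k = 0 by rewrite (adjointB hH hV) (adjointKK hH hU hV) subrr.
  have := hxy (k, 0); rewrite polar_adj ip0l /= => /(_ _)/esym; rewrite ipBr -/k.
  rewrite -[ip k (U _)](adjointC hV) Vk ip0l subr0; apply.
  exact: (proj1 (psa_linear pP)).
rewrite TE; exists (V y) => //=; apply: (psa_maximal pP) => d d' Pd.
rewrite -hV; apply: (hxy (U d, d')); rewrite polar_adj /=.
exact: (psa_proj hH hU hV pP polar_ker d d').1 Pd.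
Qed.

Lemma polar_op_abs_adj : op_abs ip (adj ip T) = conjugate_relation U V P.
Proof.
apply: (op_sqrtE hH (conjugate_relation_psa hH hU hV pP polar_ker)).
rewrite (conjugate_relation_comp hH hU hV pP polar_ker) polar_adj_adj polar_adj TE graph_compE.
apply/seteqP; split=> [[x y] [w [v /= Pv Pw] /= ->]|[x y] [v /= Pv [w /= Pw ->]]].
  by exists v => //; exists w.
by exists w => //; exists v.
Qed.

Lemma polar_right : T = op_abs ip (adj ip T) \; graph U.
Proof.
rewrite polar_op_abs_adj TE comp_graphE graph_compE; have proj := psa_proj hH hU hV pP polar_ker.
apply/seteqP; split=> [[x y] [v /= Pv ->]|[x y] [v /= Pv ->]].
  by exists v => //=; exact: (proj x v).1 Pv.
by exists v => //; exact: (proj x v).2 Pv.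
Qed.

Variables (S : set (H * H)) (pS : positive_selfadjoint ip S) (SS : S \; S = P).

Lemma polar_sqrt_ker k : U k = 0 -> S (k, 0).
Proof.
move=> /polar_ker; rewrite -SS => -[s /= Sk Ss].
have s0 : s = 0 by apply: (ip_self_eq0 hH); rewrite (psa_sym pS Sk Ss) ip0r.
by rewrite s0 in Sk.
Qed.

Lemma polar_sqrt_abs_adj : op_sqrt ip (op_abs ip (adj ip T)) = conjugate_relation U V S.
Proof.
apply: (op_sqrtE hH (conjugate_relation_psa hH hU hV pS polar_sqrt_ker)).
by rewrite (conjugate_relation_comp hH hU hV pS polar_sqrt_ker) SS polar_op_abs_adj.
Qed.

End PolarDecomposition.

(** * Graph norms compared with a complete norm on the domain *)

Section GraphNorms.
Context (R : realType) (H : completeNormedModType R[i]).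
Context (ip : {dot H for (@Num.conj R[i])}) (hH : induces_norm ip).
Implicit Types (x y z : H) (a e : R[i]) (B : set (H * H)).

(* On [dom B] this is equivalent to the graph norm, and it makes [1 + B] an
   isometry onto [H]. *)
Definition shift_norm B x : R[i] := `|x + app B x|.

Variables (B : set (H * H)) (pB : positive_selfadjoint ip B).

Lemma shift_norm_ge x : dom B x -> `|x| <= shift_norm B x.
Proof. by move=> /(psa_app hH pB) /(psa_norm_dom hH pB). Qed.

Lemma shift_norm_on : norm_on (dom B) (shift_norm B).
Proof.
split=> [x _|x Bx Nx|a x Bx|x y Bx By]; first exact: normr_ge0.
- by apply/eqP; rewrite -normr_le0 -Nx shift_norm_ge.
- have := psa_app_linear hH pB a Bx (proj1 (psa_dom_subspace pB)).
  rewrite addr0 (psa_appE hH pB (proj1 (psa_linear pB))) addr0 /shift_norm => ->.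
  by rewrite -scalerDr normrZ.
have := psa_app_linear hH pB 1 Bx By; rewrite !scale1r /shift_norm => ->.
by rewrite addrACA ler_normD.
Qed.

Lemma shift_norm_banach : banach_on (dom B) (shift_norm B).
Proof.
move=> u Bu cu; have lin := psa_app_linear hH pB.
have appB x y : dom B x -> dom B y -> app B (x - y) = app B x - app B y.
  by move=> Bx By; have := lin (-1) _ _ By Bx; rewrite !scaleN1r ![- _ + _]addrC.
have dB x y : dom B x -> dom B y -> dom B (x - y).
  exact: (subspaceB (psa_dom_subspace pB)).
have [e e0|w _ uw] := banach_on_setT (u := fun n => u n + app B (u n)) (fun n => I).
  have [n0 h] := cu e e0; exists n0 => m n hm hn.
  have := h m n hm hn; rewrite /shift_norm appB //.
  by congr (`|_| < _); apply: (ip_injl hH) => t; rewrite !ipE; ring.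
have [x Bx Bxw] := psa_resolvent_surj hH pB w.
exists x => // e e0; have [n0 h] := uw e e0; exists n0 => n hn.
rewrite /shift_norm appB // (psa_appE hH pB Bxw).
by have := h n hn; congr (`|_| < _); apply: (ip_injl hH) => t; rewrite !ipE; ring.
Qed.

(** Positivity gives the first bound; the parallelogram law gives the second with the square root of
    2, rounded up to 2. *)
Lemma graph_norm_bounds x : dom B x ->
  graph_norm B x <= shift_norm B x /\ shift_norm B x <= 2%:R * graph_norm B x.
Proof.
move=> /(psa_app hH pB) Bx; rewrite /shift_norm /graph_norm.
have g0 : 0 <= `|x| ^+ 2 + `|app B x| ^+ 2 by rewrite addr_ge0 ?exprn_ge0.
split; rewrite -(ler_pXn2r (n := 2)) ?nnegrE ?mulr_ge0 ?sqrtC_ge0 //.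
  by rewrite sqrtCK; exact: (psa_sqr_norm hH pB Bx).
rewrite exprMn sqrtCK.
apply: (@le_trans _ _ (2%:R * (`|x| ^+ 2 + `|app B x| ^+ 2))).
  rewrite mulrDr -(parallelogram hH) lerDl exprn_ge0 //.
by rewrite ler_wpM2r // -natrX ler_nat.
Qed.

Lemma norm_lim_unique (u : nat -> H) x y :
  (forall e : R[i], 0 < e -> exists n0, forall n, (n0 <= n)%N -> `|u n - x| < e) ->
  (forall e : R[i], 0 < e -> exists n0, forall n, (n0 <= n)%N -> `|u n - y| < e) ->
  x = y.
Proof.
move=> ux uy; apply/eqP; rewrite -subr_eq0 -normr_le0; apply/ler_addgt0Pr => e e0.
have e2 : 0 < e / 2%:R by rewrite divr_gt0.
have [n1 h1] := ux _ e2; have [n2 h2] := uy _ e2; set n := maxn n1 n2.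
have -> : x - y = (x - u n) + (u n - y) by rewrite addrA subrK.
rewrite add0r; apply: (le_trans (ler_normD _ _)); rewrite [e]splitr; apply: lerD.
  by rewrite distrC; apply/ltW/h1; rewrite leq_maxl.
by apply/ltW/h2; rewrite leq_maxr.
Qed.

Variables (D : set H) (N : H -> R[i]) (alpha : R[i]).
Hypotheses (DB : D = dom B) (hN : norm_on D N) (cN : banach_on D N).
Hypotheses (alpha0 : 0 < alpha) (Nalpha : forall x, D x -> `|x| <= alpha * N x).

(** Both norms dominate that of [H], so limits in the two of them coincide; this is the closed graph
    condition in both directions. *)
Lemma shift_norm_equivalent : equivalent_norms D N (shift_norm B).
Proof.
have hD : linear_subspace D by rewrite DB; exact: psa_dom_subspace pB.
have hS : norm_on D (shift_norm B) by rewrite DB; exact: shift_norm_on.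
have cS : banach_on D (shift_norm B) by rewrite DB; exact: shift_norm_banach.
have limN (u : nat -> H) x : (forall n, D (u n)) -> D x ->
    (forall e : R[i], 0 < e -> exists n0, forall n, (n0 <= n)%N -> N (u n - x) < e) ->
    (forall e : R[i], 0 < e -> exists n0, forall n, (n0 <= n)%N -> `|u n - x| < e).
  move=> Du Dx h e e0; have [|n0 hn0] := h (e / alpha); first by rewrite divr_gt0.
  exists n0 => n hn; apply: (le_lt_trans (Nalpha (subspaceB hD (Du n) Dx))).
  by rewrite mulrC -ltr_pdivlMr //; exact: hn0.
have limS (u : nat -> H) x : (forall n, D (u n)) -> D x ->
    (forall e : R[i], 0 < e -> exists n0, forall n, (n0 <= n)%N -> shift_norm B (u n - x) < e) ->
    (forall e : R[i], 0 < e -> exists n0, forall n, (n0 <= n)%N -> `|u n - x| < e).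
  move=> Du Dx h e e0; have [n0 hn0] := h e e0.
  exists n0 => n hn; apply: le_lt_trans (hn0 n hn); apply: shift_norm_ge.
  by rewrite -DB; exact: (subspaceB hD (Du n) Dx).
have [|C C0 hC] := banach_norm_dominated hD hN hS cN cS.
  by move=> u x y Du Dx Dy ux uy; apply: (norm_lim_unique (limN u x _ _ _) (limS u y _ _ _)).
have [|C' C'0 hC'] := banach_norm_dominated hD hS hN cS cN.
  by move=> u x y Du Dx Dy ux uy; apply: (norm_lim_unique (limS u x _ _ _) (limN u y _ _ _)).
exists (1 / C), C'; split=> // [|x Dx]; first by rewrite divr_gt0.
by split; [rewrite mul1r ler_pdivrMl // hC | exact: hC'].
Qed.

Lemma graph_norm_equivalent : equivalent_norms D N (graph_norm B).
Proof.
have [c [C [c0 C0 h]]] := shift_norm_equivalent.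
exists (c / 2%:R), C; split=> // [|x Dx]; first by rewrite divr_gt0.
have Bx : dom B x by rewrite -DB.
have [h1 h2] := h x Dx; have [h3 h4] := graph_norm_bounds Bx.
split; last exact: le_trans h3 h2.
by rewrite mulrAC ler_pdivrMr // [_ * 2%:R]mulrC; exact: le_trans h1 h4.
Qed.

End GraphNorms.

(** * Surjectivity of the adjoint of a bounded bijection *)

Section AdjointSurjectivity.
Context (R : realType) (H : completeNormedModType R[i]).
Context (ip : {dot H for (@Num.conj R[i])}) (hH : induces_norm ip).
Implicit Types (x y z : H) (a e : R[i]).
Variables (Q : H -> H -> R[i]) (K : R[i]).
Hypotheses (hQ : sesquilinear_on setT Q) (K0 : 0 < K).
Hypothesis QK : forall x y, `|Q x y| <= K * `|x| * `|y|.
Hypothesis Qinj : forall x, (forall y, Q x y = 0) -> x = 0.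
Hypothesis Qsurj : forall h, exists x, forall y, Q x y = ip h y.

(** [Q] is represented by a bounded bijection [G], and [|G x|] is a second complete norm on [H]. The
    closed graph theorem thus bounds the inverse of [G], and Riesz applied to [h |-> ip (G^-1 h) k]
    provides [y]. *)
Lemma bounded_form_adjoint_surjective k : exists y, forall x, Q x y = ip x k.
Proof.
have Ql a x y z : Q (a *: x + y) z = a * Q x z + Q y z by case: (@hQ a x y z I I I).
have Qr a x y z : Q z (a *: x + y) = a^* * Q z x + Q z y by case: (@hQ a x y z I I I).
have [G hG] : {G : H -> H | forall x y, Q x y = ip (G x) y}.
  have [|G hG] := @choice _ _ (fun x g => forall y, Q x y = ip g y); last by exists G.
  move=> x; have [|g hg] := @riesz R H ip hH (fun y => (Q x y)^*).
    split=> [a y z _ _|]; first by rewrite Qr rmorphD rmorphM /= conjCK.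
    by exists (K * `|x|) => y _; rewrite norm_conjC.
  by exists g => y; rewrite -[Q x y]conjCK hg -ipC.
have Glin a x y : G (a *: x + y) = a *: G x + G y.
  by apply: (ip_injl hH) => z; rewrite !ipE -!hG Ql.
have GB x y : G (x - y) = G x - G y.
  by have := Glin (-1) y x; rewrite !scaleN1r ![- _ + _]addrC.
have GK x : `|G x| <= K * `|x|.
  have [->|Gx0] := eqVneq (G x) 0; first by rewrite normr0 mulr_ge0 // ltW.
  have : `|G x| ^+ 2 <= K * `|x| * `|G x|.
    by rewrite -[`|G x| ^+ 2]ger0_norm ?exprn_ge0 // hH -hG.
  by rewrite expr2 ler_pM2r // normr_gt0.
have Ginj x : G x = 0 -> x = 0.
  by move=> Gx; apply: Qinj => y; rewrite hG Gx ip0l.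
have [G' hG'] : {G' : H -> H | forall h, G (G' h) = h}.
  have [|G' hG'] := @choice _ _ (fun h x => G x = h); last by exists G'.
  by move=> h; have [x hx] := Qsurj h; exists x; apply: (ip_injl hH) => y; rewrite -hG.
have hT : linear_subspace [set: H] by split.
have G0 : G 0 = 0 by have := GB 0 0; rewrite !subrr.
have nG : norm_on setT (fun x => `|G x|).
  split=> [x _|x _ /eqP|a x _|x y _ _]; first exact: normr_ge0.
  - by rewrite normr_eq0 => /eqP; exact: Ginj.
  - by have := Glin a x 0; rewrite G0 !addr0 => ->; rewrite normrZ.
  - by have := Glin 1 x y; rewrite !scale1r => ->; exact: ler_normD.
have cG : banach_on setT (fun x => `|G x|).
  move=> u _ cu; have [e e0|h _ uh] := banach_on_setT (u := fun n => G (u n)) (fun n => I).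
    by have [n0 hn0] := cu e e0; exists n0 => m n hm hn; rewrite -GB; exact: hn0.
  exists (G' h) => // e e0; have [n0 hn0] := uh e e0.
  by exists n0 => n hn; rewrite GB hG'; exact: hn0.
have [|C C0 hC] := banach_norm_dominated hT (norm_on_norm _) nG (banach_on_setT (H := H)) cG.
  move=> u x y _ _ _ ux uy; apply/eqP; rewrite -subr_eq0; apply/eqP/Ginj.
  rewrite GB; apply/eqP; rewrite subr_eq0; apply/eqP.
  apply: (@norm_lim_unique R H (fun n => G (u n))) => e e0; last first.
    by have [n0 hn0] := uy e e0; exists n0 => n hn; rewrite -GB; exact: hn0.
  have [|n0 hn0] := ux (e / K); first by rewrite divr_gt0.
  exists n0 => n hn; rewrite -GB; apply: (le_lt_trans (GK _)).
  by rewrite mulrC -ltr_pdivlMr //; exact: hn0.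
have G'lin a x y : G' (a *: x + y) = a *: G' x + G' y.
  apply/eqP; rewrite -subr_eq0; apply/eqP/Ginj.
  by rewrite GB Glin !hG' subrr.
have [|v hv] := @riesz R H ip hH (fun h => ip (G' h) k).
  split=> [a x y _ _|]; first by rewrite G'lin !ipE.
  exists (C * `|k|) => x _; apply: (le_trans (ip_cauchy_schwarz hH _ _)).
  by rewrite mulrAC ler_wpM2r // -[x in leRHS]hG'; exact: hC.
exists v => x; rewrite hG -hv; congr (ip _ _).
by apply/eqP; rewrite -subr_eq0; apply/eqP/Ginj; rewrite GB hG' subrr.
Qed.

End AdjointSurjectivity.

(** * Representation of the form and identification of its domain *)

Section Representation.
Context (R : realType) (H : completeNormedModType R[i]).
Context (ip : {dot H for (@Num.conj R[i])}) (hH : induces_norm ip).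
Implicit Types (x y z : H) (a e : R[i]).
Variables (D : set H) (N : H -> R[i]) (Omega : H -> H -> R[i]).
Hypotheses (hN : norm_on D N) (hOmega : sesquilinear_on D Omega).
Hypothesis qOmega : q_closed D N Omega.
Variables (U : {linear H -> H}) (S : set (H * H)).
Hypotheses (hU : partial_isometry ip U) (pS : positive_selfadjoint ip S).
Hypotheses (DS : D = dom S) (TE : associated_operator ip D Omega = graph U \; (S \; S)).
Hypothesis kerS : forall k, U k = 0 -> S (k, 0).
Variables (V : H -> H) (hV : forall x y, ip (U x) y = ip x (V y)).
Variables (J : H -> H) (hJ : forall z, S (J z, z - J z)).

Let hD : linear_subspace D.
Proof. by rewrite DS; exact: (psa_dom_subspace pS). Qed.

Let DJ z : D (J z).
Proof. by rewrite DS; exact: (resolvent_dom hJ). Qed.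

Let shift_equiv : equivalent_norms D N (shift_norm S).
Proof.
case: qOmega => -[alpha alpha0 hal] cN _ _.
exact: (shift_norm_equivalent hH pS DS hN cN alpha0 hal).
Qed.

Let shiftJ z : shift_norm S (J z) = `|z|.
Proof. by rewrite /shift_norm (psa_appE hH pS (hJ z)) addrCA subrr addr0. Qed.

Let NJ : exists2 C, 0 < C & forall z, N (J z) <= C * `|z|.
Proof.
have [c [C [c0 _ h]]] := shift_equiv; exists (1 / c); first by rewrite divr_gt0.
by move=> z; rewrite mulrAC mul1r ler_pdivlMr // mulrC -shiftJ (h _ (DJ z)).1.
Qed.

Let Omega_bounded : exists2 b, 0 < b & forall x y, D x -> D y -> `|Omega x y| <= b * N x * N y.
Proof. by case: qOmega. Qed.

(* For [z] in [dom S] the vector [J z] lies in [dom |T|], so [<S z, V y>] equals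
   [Omega (J z) y + <z - J z, V y>]; the right-hand side is a bounded functional
   of [z], which puts [V y] in the domain of the adjoint of [S]. *)
Lemma form_dom_adjoint y : D y -> dom S (V y) /\
  forall x, D x -> Omega x y = ip (app S x) (app S (V y)).
Proof.
move=> Dy; have [k hk] : exists k, forall z, Omega (J z) y + ip (z - J z) (V y) = ip z k.
  apply: (riesz hH (f := fun z => Omega (J z) y + ip (z - J z) (V y))); split.
    move=> a s t _ _; rewrite (resolvent_linear hH pS hJ) (hOmega a (DJ s) (DJ t) Dy).1.
    by rewrite !ipE; ring.
  have [C C0 hC] := NJ; have [b b0 hb] := Omega_bounded.
  exists (b * C * N y + `|V y|) => z _.
  apply: (le_trans (ler_normD _ _)); rewrite mulrDl; apply: lerD.
    apply: (le_trans (hb _ _ (DJ z) Dy)).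
    rewrite [X in _ <= X]mulrAC ler_wpM2r ?(norm_on_ge0 hN) // -mulrA.
    by rewrite ler_pM2l.
  apply: (le_trans (ip_cauchy_schwarz hH _ _)).
  by rewrite mulrC ler_wpM2l // (resolvent_compl_norm hH pS hJ).
have SVy : S (V y, k).
  apply: (psa_maximal pS) => z z' Sz; rewrite -hk.
  have Sd := linear_relationB (psa_linear pS) Sz (hJ z).
  have [_ ->//] : associated_operator ip D Omega (J z, U (z' - (z - J z))).
    by rewrite TE graph_compE; exists (z' - (z - J z)) => //; exists (z - J z); first exact: hJ.
  by rewrite /= hV -ipDl subrK.
split=> [|x]; first by exists (V y, k).
rewrite DS => /(psa_app hH pS) Sx; rewrite (psa_appE hH pS SVy).
(* At [z = x + S x] one has [J z = x] and [z - J z = S x]; this carries the identity from the domain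
   of [T] to all of [D]. *)
have := hk (x + app S x); rewrite (resolventE hH pS hJ Sx).
have -> : x + app S x - x = app S x by rewrite addrAC subrr add0r.
by rewrite (psa_sym pS Sx SVy) ipDl [ip x k + _]addrC => /addIr.
Qed.

Variable (Y : H -> H -> R[i]).
Hypothesis hY : perturbations D N Omega Y.

(* Adjoint surjectivity of [Omega + Y] yields [J v] in [D] that represents the
   same functional as [y]; the difference [y - J v] is then orthogonal to the
   range of [T + Y], which is all of [H]. *)
Lemma form_dom_adjoint_sub y : dom S (V y) -> D y.
Proof.
move=> dVy; case: hY => -[sY [M hM]] Yinj Ysurj.
have [C C0 hC] := NJ; have [b b0 hb] := Omega_bounded.
have hM' x z : `|Y x z| <= `|M| * (`|x| * `|z|).
  have h : `|Y x z| <= M * (`|x| * `|z|) by rewrite mulrA.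
  apply: (le_trans h); rewrite -[X in _ <= _ * X]ger0_norm ?mulr_ge0 // -normrM.
  by rewrite ger0_norm // (le_trans _ h).
have Ylin a x x' z : Y (a *: x + x') z = a * Y x z + Y x' z by case: (sY a x x' z I I I).
have Ylinr a x x' z : Y z (a *: x + x') = a^* * Y z x + Y z x' by case: (sY a x x' z I I I).
have Jlin := resolvent_linear hH pS hJ.
have JE x : D x -> J (x + app S x) = x.
  by rewrite DS => /(psa_app hH pS) Sx; exact: (resolventE hH pS hJ Sx).
have [v hv] : exists v, forall z, Omega (J z) (J v) + Y (J z) (J v)
    = ip (app S (J z)) (app S (V y)) + Y (J z) y.
  have [k hk] : exists k, forall z, ip (z - J z) (app S (V y)) + Y (J z) y = ip z k.
    apply: (riesz hH (f := fun z => ip (z - J z) (app S (V y)) + Y (J z) y)); split.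
      by move=> a s t _ _; rewrite Jlin Ylin !ipE; ring.
    exists (`|app S (V y)| + `|M| * `|y|) => z _.
    apply: (le_trans (ler_normD _ _)); rewrite mulrDl; apply: lerD.
      apply: (le_trans (ip_cauchy_schwarz hH _ _)).
      by rewrite mulrC ler_wpM2l // (resolvent_compl_norm hH pS hJ).
    apply: (le_trans (hM' _ _)); rewrite -mulrA ler_wpM2l // mulrC ler_wpM2l //.
    exact: (resolvent_norm hH pS hJ).
  have [|||||v hv] := @bounded_form_adjoint_surjective R H ip hH
      (fun z w => Omega (J z) (J w) + Y (J z) (J w)) (b * C * C + `|M| + 1) _ _ _ _ _ k.
  - move=> a s t w _ _ _; rewrite Jlin Ylin Ylinr.
    by have [-> ->] := hOmega a (DJ s) (DJ t) (DJ w); split; ring.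
  - by rewrite ltr_wpDl // addr_ge0 // !mulr_ge0 // ltW.
  - move=> z w; apply: (le_trans (ler_normD _ _)).
    rewrite -mulrA [X in _ <= X]mulrDl mul1r [X in _ <= X + _]mulrDl.
    rewrite -[X in X <= _]addr0 lerD ?mulr_ge0 // lerD //.
      apply: (le_trans (hb _ _ (DJ z) (DJ w))).
      rewrite -!mulrA ler_pM2l // [X in _ <= X](_ : _ = (C * `|z|) * (C * `|w|)); last by ring.
      by rewrite ler_pM ?(norm_on_ge0 hN).
    apply: (le_trans (hM' _ _)); rewrite ler_wpM2l // ler_pM //; exact: (resolvent_norm hH pS hJ).
  - move=> z hz; suff Jz0 : J z = 0.
      have := hJ z; rewrite Jz0 subr0 => Sz.
      exact: (psa_functional hH pS Sz (proj1 (psa_linear pS))).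
    by apply: Yinj => // w Dw; rewrite -(JE w Dw); exact: hz.
  (* For [w = J z] the vector [w + S w] is [z], so representing [w |-> ip h (w + S w)] on [D] solves
     the pulled-back problem; norm equivalence makes this functional [N]-bounded. *)
  - move=> h; have [c [C' [c0 C'0 hshift]]] := shift_equiv.
    have [|| x Dx hx] := Ysurj (fun w => ip h (w + app S w)).
    + move=> a s t Ds Dt; rewrite DS in Ds Dt.
      by rewrite (psa_app_linear hH pS a Ds Dt) !ipE; ring.
    + exists (`|h| * C') => w Dw; apply: (le_trans (ip_cauchy_schwarz hH _ _)).
      by rewrite -mulrA ler_wpM2l //; exact: (hshift w Dw).2.
    exists (x + app S x) => w; rewrite (JE x Dx) -hx //.
    by rewrite (psa_appE hH pS (hJ w)) addrCA subrr addr0.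
  exists v => z; rewrite hv -hk (psa_appE hH pS (hJ z)) //.
suff -> : y = J v by [].
apply/eqP; rewrite -subr_eq0; apply/eqP/(ip_self_eq0 hH); set w := y - J v.
have [dVJ hOJ] := form_dom_adjoint (DJ v).
have Vw : S (V w, app S (V y) - app S (V (J v))).
  rewrite (adjointB hH hV); apply: (linear_relationB (psa_linear pS)); exact: (psa_app hH pS).
have wY x : D x -> ip (app S x) (app S (V w)) + Y x w = 0.
  move=> Dx; have := hv (x + app S x); rewrite (JE x Dx) hOJ // (psa_appE hH pS Vw) ipBr.
  have -> : Y x w = Y x y - Y x (J v).
    have := Ylinr (-1) (J v) y x; rewrite scaleN1r [- _ + _]addrC => ->.
    by rewrite rmorphN /= conjC1; ring.
  move=> /eqP; rewrite -subr_eq0 => /eqP h.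
  by apply/eqP; rewrite -oppr_eq0; apply/eqP; rewrite -h; ring.
have [alpha alpha0 hal] : exists2 alpha : R[i], 0 < alpha & forall x, D x -> `|x| <= alpha * N x.
  by case: qOmega.
(* With this [x], and [h] representing [Y x], one gets [T x = w - h]. Then
   [ip w w = ip (T x) w + Y x w], which [wY] says is zero. *)
have [||x Dx hx] := Ysurj (fun z => ip w z).
- by move=> a s t _ _; rewrite ipDr ipZr.
- exists (`|w| * alpha) => z Dz; apply: (le_trans (ip_cauchy_schwarz hH _ _)).
  by rewrite -mulrA ler_wpM2l // hal.
have [h hh] : exists h, forall z, Y x z = ip h z.
  have [|h hh] := @riesz R H ip hH (fun z => (Y x z)^*).
    split=> [a s t _ _|]; first by rewrite Ylinr rmorphD rmorphM /= conjCK.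
    by exists (`|M| * `|x|) => z _; rewrite norm_conjC -mulrA.
  by exists h => z; rewrite -[Y x z]conjCK hh -ipC.
have : associated_operator ip D Omega (x, w - h).
  by split=> //= z Dz; rewrite ipBl hx // hh addrK.
rewrite TE graph_compE => -[p [q /= Sx Sq] wE].
have := wY x Dx; rewrite (psa_appE hH pS Sx) hh.
rewrite -(psa_sym pS Sq (psa_app hH pS _)) //; last by exists (V w, app S (V y) - app S (V (J v))).
by rewrite -hV -wE ipBl subrK.
Qed.

End Representation.

Theorem theorem4p17 (R : realType) (H : completeNormedModType R[i])
    (ip : {dot H for (@Num.conj R[i])}) (hH : induces_norm ip)
    (D : set H) (hD : linear_subspace D) (dD : dense D)
    (N : H -> R[i]) (hN : norm_on D N)
    (Omega : H -> H -> R[i]) (hOmega : sesquilinear_on D Omega)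
    (hyp : hyper_solvable ip D N Omega)
    (T : set (H * H)) (hT : T = associated_operator ip D Omega)
    (U : {linear H -> H}) (hU : polar_decomposition ip T U) :
  let S := op_sqrt ip (op_abs ip T) in
  let S' := op_sqrt ip (op_abs ip (adj ip T)) in
  [/\ D = dom S',
      forall x y, D x -> D y -> Omega x y = ip (U (app S x)) (app S' y),
      forall x y, D x -> D y ->
        dom S' (U x) /\ Omega x y = ip (app S' (U x)) (app S' y),
      T = op_abs ip (adj ip T) \; graph U &
      equivalent_norms D N (graph_norm S) /\
      equivalent_norms D N (graph_norm S')].
Proof.
move=> S S'; case: hyp => -[qO [Y hY]]; rewrite -hT -/S => DS.
(* [D] contains 0, whereas the fallback empty relation has an empty domain. *)
have [pS SS] : positive_selfadjoint ip S /\ S \; S = op_abs ip T.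
  apply: op_sqrtP; apply/set0P/eqP => S0; move: hD => [+ _]; rewrite DS.
  by case=> p; rewrite /S S0.
have lS := psa_linear pS.
have [pP PP] : positive_selfadjoint ip (op_abs ip T) /\
    op_abs ip T \; op_abs ip T = adj ip T \; T.
  apply: op_sqrtP; exists (0, 0); rewrite -/(op_abs ip T) -SS.
  by exists 0; exact: (proj1 lS).
case: hU => pU TE kerT.
have [V hV] := partial_isometry_adjoint hH pU.
have kerS := polar_sqrt_ker hH pP PP TE kerT pS SS.
have S'E : S' = conjugate_relation U V S := polar_sqrt_abs_adj hH pU pP PP TE kerT hV pS SS.
have pS' : positive_selfadjoint ip S'.
  rewrite S'E; exact: (conjugate_relation_psa hH pU hV pS kerS).
have [J hJ] := psa_resolvent hH pS.
have TE' : associated_operator ip D Omega = graph U \; (S \; S) by rewrite -hT SS.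
have repr := form_dom_adjoint hH hN hOmega qO pS DS TE' hV hJ.
have sub := form_dom_adjoint_sub hH hN hOmega qO pS DS TE' hV hJ hY.
have S'dom y : D y -> S' (y, U (app S (V y))).
  move=> /repr[dVy _]; rewrite S'E; exists (app S (V y)) => //=.
  exact: (psa_app hH pS).
have S'app y : D y -> app S' y = U (app S (V y)).
  by move=> /S'dom; exact: (psa_appE hH pS').
have DS' : D = dom S'.
  apply/seteqP; split=> [y Dy|y [[y0 w] + <-]].
    by exists (y, U (app S (V y))) => //; exact: S'dom.
  rewrite S'E => -[v /= Sv _]; apply: sub; by exists (V y0, v).
have ranK := psa_ran_ker_orthogonal hH pU hV pS kerS.
have SU x : D x -> S (x, app S x) by rewrite DS; exact: (psa_app hH pS).
have form x y : D x -> D y -> Omega x y = ip (U (app S x)) (app S' y).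
  move=> Dx Dy; have [dVy ->//] := repr y Dy.
  (* Moving [U] across leaves [V (U (S x))], which is [S x] because the range of [S] lies in the
     initial space of [U]. *)
  rewrite S'app // -[in RHS](adjointC hV).
  by rewrite (ranK _ _ (SU x Dx)).
split=> //.
- move=> x y Dx Dy.
  (* [S' U = U S V U] acts on [D] as [U S], since [x] and [V (U x)] differ by a vector killed by
     [S]; the second formula reduces to the first. *)
  have S'U : S' (U x, U (app S x)).
    rewrite S'E; exists (app S x) => //=.
    exact: (psa_proj hH pU hV pS kerS x (app S x)).1 (SU x Dx).
  by split; [exists (U x, U (app S x)) | rewrite (psa_appE hH pS' S'U) form].
- exact: (polar_right hH pU pP PP TE kerT hV).
have [alpha alpha0 hal] : exists2 alpha : R[i], 0 < alpha & forall x, D x -> `|x| <= alpha * N x.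
  by case: qO.
have cN : banach_on D N by case: qO.
by split; [apply: (graph_norm_equivalent hH pS DS hN cN alpha0 hal)
          |apply: (graph_norm_equivalent hH pS' DS' hN cN alpha0 hal)].
Qed.
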